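(* Let $H$ be a fixed graph and let $a,b$ be positive integers. Then the threshold probability for Waiter's win in the $(a:b)$ Waiter-Client vertex $H$-game played on $G\sim G(n,p)$ is $n^{-1/m(H)}$: if $p=\omega(n^{-1/m(H)})$ then w.h.p. Waiter wins, and if $p=o(n^{-1/m(H)})$ then w.h.p. Client wins. Furthermore, if $H$ is strictly balanced, then there exists a constant $N=N(a,b,v(H))$ such that for the random graph process $\tilde G$, w.h.p. $\tau(\tilde G,\mathcal W)=\tau(\tilde G,\mathcal G_{NH})$, where $\mathcal W$ is the property of being Waiter's win in the $(a:b)$ Waiter-Client vertex $H$-game.
   Context: For a graph $F$, $d(F)=e(F)/v(F)$, $m(F)=\max\{d(F'):F'\subseteq F\}$; $F$ is strictly balanced if $d(F)>d(F')$ for every proper subgraph $F'\subsetneq F$. The $(a:b)$ Waiter-Client vertex $H$-game on a graph $G$: in each round Waiter selects $a+b$ previously unclaimed vertices, Client chooses $a$ of them to claim and Waiter claims the rest; in the last round, if $t\le a+b$ free vertices remain, Waiter claims all of them if $t\le b$, and otherwise Client claims $t-b$ of them and Waiter the rest. Waiter wins if the subgraph of $G$ induced by Client's vertices contains a (not necessarily induced) copy of $H$, and Client wins otherwise. $G(n,p)$ is the binomial random graph. The random graph process $\tilde G=(G_i)$ on $[n]$ adds the edges of $K_n$ one by one in uniformly random order; $\tau(\tilde G,\mathcal P)=\min\{i:G_i\in\mathcal P\}$. $\mathcal G_{NH}$ is the property of containing $N$ (possibly intersecting) copies of $H$. ''W.h.p.'' means with probability tending to 1 as $n\to\infty$. 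*)

(* Defs.v *)
From Stdlib Require Import Reals.
From mathcomp Require Import all_boot.
Set Implicit Arguments. Unset Strict Implicit. Unset Printing Implicit Defensive.

Definition pairs (n : nat) : {set {set 'I_n}} := [set e : {set 'I_n} | #|e| == 2].
Definition is_graph (n : nat) (E : {set {set 'I_n}}) : bool := E \subset pairs n.

Definition embeds (k n : nat) (EH : {set {set 'I_k}}) (EG : {set {set 'I_n}})
  (C : {set 'I_n}) (f : {ffun 'I_k -> 'I_n}) : bool :=
  [&& injectiveb f, [forall x, f x \in C] & [forall e in EH, (f @: e) \in EG]].

Definition hasH (k n : nat) (EH : {set {set 'I_k}}) (EG : {set {set 'I_n}})
  (C : {set 'I_n}) : bool := [exists f : {ffun 'I_k -> 'I_n}, embeds EH EG C f].

(* Waiter wins the (a:b) Waiter-Client vertex H-game on G from the position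
   with free vertices F and Client's vertices C (fuel = number of rounds left). *)
Fixpoint ww (k n : nat) (EH : {set {set 'I_k}}) (EG : {set {set 'I_n}})
  (a b fuel : nat) (F C : {set 'I_n}) : bool :=
  match fuel with
  | 0 => hasH EH EG C
  | fuel'.+1 =>
    if #|F| <= a + b then
      (* last round: Client claims t - b of the t free vertices (none if t <= b) *)
      [forall D : {set 'I_n},
         ((D \subset F) && (#|D| == #|F| - b)) ==> hasH EH EG (C :|: D)]
    else
      [exists S : {set 'I_n}, [&& S \subset F, #|S| == a + b &
        [forall D : {set 'I_n},
           ((D \subset S) && (#|D| == a)) ==> ww EH EG a b fuel' (F :\: S) (C :|: D)]]]
  end.

(* Waiter wins the game on G (n.+1 rounds are more than enough). *)
Definition WaiterWin (k : nat) (EH : {set {set 'I_k}}) (a b : nat) (n : nat)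
  (EG : {set {set 'I_n}}) : bool :=
  ww EH EG a b n.+1 [set: 'I_n] set0.

(* Distinct copies of H in G (a copy = subgraph of G isomorphic to H). *)
Definition copies (k n : nat) (EH : {set {set 'I_k}}) (EG : {set {set 'I_n}})
  : {set {set 'I_n} * {set {set 'I_n}}} :=
  [set (((f : {ffun 'I_k -> 'I_n}) @: [set: 'I_k]), ((fun e : {set 'I_k} => f @: e) @: EH)) |
     f : {ffun 'I_k -> 'I_n} & embeds EH EG [set: 'I_n] f].

Definition hasNcopies (N k : nat) (EH : {set {set 'I_k}}) (n : nat)
  (EG : {set {set 'I_n}}) : bool := N <= #|copies EH EG|.

Local Open Scope R_scope.

Definition prob_Gnp (n : nat) (p : R) (P : {set {set 'I_n}} -> bool) : R :=
  foldr Rplus 0 (map (fun E : {set {set 'I_n}} =>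
                        p ^ #|E| * (1 - p) ^ (#|pairs n| - #|E|)%N)
                   (filter P (enum (powerset (pairs n))))).

(* Random graph process: s is an ordering of the edges of K_n; G_i = first i edges. *)
Definition Gi (n : nat) (s : seq {set 'I_n}) (i : nat) : {set {set 'I_n}} :=
  [set e | e \in take i s].
(* hitting time tau(s, P) = min{i : G_i in P} (size s + 1 if never) *)
Definition tau (n : nat) (s : seq {set 'I_n}) (P : {set {set 'I_n}} -> bool) : nat :=
  find (fun i => P (Gi s i)) (iota 0 (size s).+1).
Definition prob_process (n : nat) (Q : seq {set 'I_n} -> bool) : R :=
  (INR (count Q (permutations (enum (pairs n))))
   / INR (size (permutations (enum (pairs n))))).

Definition is_subgraph (k : nat) (EH : {set {set 'I_k}})
  (x : {set 'I_k} * {set {set 'I_k}}) : bool :=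
  [&& x.1 != set0, x.2 \subset EH & [forall e in x.2, e \subset x.1]].
Definition dens (k : nat) (x : {set 'I_k} * {set {set 'I_k}}) : R :=
  (INR #|x.2| / INR #|x.1|).
Definition mH (k : nat) (EH : {set {set 'I_k}}) : R :=
  foldr Rmax 0 (map (@dens k) (enum [pred x | is_subgraph EH x])).
Definition strictly_balanced (k : nat) (EH : {set {set 'I_k}}) : Prop :=
  forall x, is_subgraph EH x -> x != ([set: 'I_k], EH) ->
    (dens x < dens ([set: 'I_k], EH)).

Definition thr (k : nat) (EH : {set {set 'I_k}}) (n : nat) : R :=
  Rpower (INR n) (- / mH EH).

Definition tends_to_infty (u : nat -> R) : Prop :=
  forall M : R, exists N : nat, forall n : nat, (N <= n)%N -> (M < u n).

(* Main.v *)
(* Waiter can fill up his offers with vertices outside the copies of [H], and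
   Client has to take a vertex of a copy only when such vertices are more than
   [b] in an offer.  Hence, when the copies of [H] in [G] are pairwise disjoint and
   [n] is large, the outcome depends only on their number: it is the outcome of a
   board game on disjoint blocks of size [k], which Waiter wins on [(b + 1) ^ k]
   blocks by forcing Client to advance in one out of every [b + 1] blocks.  Let
   [N] be the least number of blocks on which Waiter wins.

   Above the threshold the second moment method yields [(b + 1) ^ k] disjoint
   copies of [H]; below it the densest subgraph of [H] does not appear at all.
   For strictly balanced [H] look at the process at density [n ^ (eps - k / e(H))]:
   by the second moment it contains [N] disjoint copies of [H], while the union of
   two distinct intersecting copies is too dense to appear, so up to that time
   being Waiter's win and containing [N] copies are the same property. *)
Require Import Defs.
From Stdlib Require Import ZArith Reals Lra Classical.
From mathcomp Require Import all_boot all_order perm all_algebra Rstruct zify.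
From mathcomp Require ring lra.
Set Implicit Arguments. Unset Strict Implicit. Unset Printing Implicit Defensive.

(** * The game on disjoint blocks *)

Lemma subset_of_card (T : finType) (A : {set T}) c :
  c <= #|A| -> exists2 B : {set T}, B \subset A & #|B| = c.
Proof.
move=> cA; exists [set x in take c (enum A)].
  by apply/subsetP=> x; rewrite inE => /mem_take; rewrite mem_enum.
rewrite cardsE; have /card_uniqP -> := take_uniq c (enum_uniq A).
by rewrite size_takel // -cardE.
Qed.

Section BoardGame.
Variables (a b : nat) (I V : finType).
Implicit Types F C S D : {set I * V}.

Definition full_block C : bool := [exists t, [forall x, (t, x) \in C]].

(* The Waiter-Client game on disjoint winning sets [{t} x V] with an unlimited
   supply of irrelevant vertices: Waiter may offer fewer than [a + b] relevant
   vertices, and Client is then forced to take only [#|S| - b] (truncated) of them. *)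
Fixpoint board_win (fuel : nat) F C : bool :=
  full_block C ||
  if fuel is fuel'.+1 then
    [exists S : {set I * V}, [&& S \subset F, #|S| <= a + b &
      [forall D : {set I * V}, ((D \subset S) && (#|D| == #|S| - b)) ==>
         board_win fuel' (F :\: S) (C :|: D)]]]
  else false.

Lemma board_win_full fuel F C : full_block C -> board_win fuel F C.
Proof. by case: fuel => [|fuel] /= ->. Qed.

End BoardGame.

Section Embedding.
Variables (k n : nat) (EH : {set {set 'I_k}}) (EG : {set {set 'I_n}}).

Lemma embedsP (C : {set 'I_n}) (f : {ffun 'I_k -> 'I_n}) :
  reflect [/\ injective f, forall x, f x \in C & forall e, e \in EH -> f @: e \in EG]
          (embeds EH EG C f).
Proof.
apply: (iffP and3P) => [[/injectiveP i /forallP c /forall_inP e]|[i c e]]; split=> //.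
- exact/injectiveP.
- exact/forallP.
- exact/forall_inP.
Qed.

Lemma hasHS (C C' : {set 'I_n}) : C \subset C' -> hasH EH EG C -> hasH EH EG C'.
Proof.
move=> /subsetP sC /existsP[f /embedsP[i c e]]; apply/existsP; exists f.
by apply/embedsP; split=> // x; apply/sC.
Qed.

End Embedding.

(** * Transfer between the graph game and the board game *)

Section WaiterClient.
Variables (k n : nat) (EH : {set {set 'I_k}}) (EG : {set {set 'I_n}}) (a b : nat).

(** Client's set only grows, so once it contains a copy Waiter may continue with arbitrary
    offers. *)
Lemma ww_hasH fuel F C : hasH EH EG C -> ww EH EG a b fuel F C.
Proof.
elim: fuel F C => [|fuel IH] F C //= hC.
case: leqP => [_|ltF].
  by apply/forallP=> D; apply/implyP=> _; apply: hasHS hC; apply: subsetUl.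
have [S sS cS] := subset_of_card (ltnW ltF); apply/existsP; exists S.
rewrite sS cS eqxx /=; apply/forallP=> D; apply/implyP=> _.
by apply: IH; apply: hasHS hC; apply: subsetUl.
Qed.

(** Any answers of the prescribed sizes do for Client: his final set cannot contain a copy that the
    whole vertex set lacks. *)
Lemma ww_noH fuel F C :
  ~~ hasH EH EG setT -> ~~ ww EH EG a b fuel F C.
Proof.
move=> noH; have noHC C' : hasH EH EG C' = false.
  by apply: contraNF noH; apply: hasHS (subsetT _).
elim: fuel F C => [|fuel IH] F C /=; first by rewrite noHC.
case: leqP => [_|ltF].
  have [D sD cD] := subset_of_card (leq_subr b #|F|).
  by apply/forallPn; exists D; rewrite sD cD eqxx noHC.
apply/existsPn=> S; apply/negP => /and3P[sS /eqP cS /forallP w].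
have [D sD cD] : exists2 D : {set _}, D \subset S & #|D| = a.
  by apply: subset_of_card; rewrite cS leq_addr.
by have := w D; rewrite sD cD eqxx /= (negbTE (IH _ _)).
Qed.

Variables (I : finType) (phi : I * 'I_k -> 'I_n).
Hypothesis phi_inj : injective phi.

(** Waiter follows the board strategy and pads each offer to size [a + b] with vertices outside the
    blocks; the bound on [F' :\: phi @: setT] keeps the padding from running out. The positions are
    related by inclusions only, since Client may take more block vertices than the board records. *)
Lemma board_win_ww fuel m F C (F' C' : {set 'I_n}) :
  (forall t, embeds EH EG setT [ffun x => phi (t, x)]) ->
  board_win a b fuel F C -> phi @: F \subset F' -> phi @: C \subset C' ->
  fuel * (a + b) < #|F' :\: phi @: setT| -> 0 < a -> #|F'| < m ->
  ww EH EG a b m F' C'.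
Proof.
move=> emb; elim: fuel m F C F' C' => [|fuel IH] m F C F' C' w sF sC fill a0 Fm.
all: have full : full_block C -> ww EH EG a b m F' C'.
1, 3: move=> /existsP[t /forallP tC]; apply: ww_hasH; apply/existsP.
1, 2: exists [ffun x => phi (t, x)]; have /embedsP[i _ e] := emb t.
1, 2: apply/embedsP; split=> // x; rewrite ffunE; apply: (subsetP sC).
1, 2: exact: imset_f.
- by move: w; rewrite /= orbF.
case/orP: w => // /existsP[S /and3P[sS cS /forallP wS]].
case: m Fm full => [|m] //= Fm _.
have cF : #|F' :\: phi @: setT| <= #|F'| by apply/subset_leq_card/subsetDl.
rewrite mulSn in fill.
have ab : a + b < #|F' :\: phi @: setT|.
  by apply: leq_ltn_trans fill; apply: leq_addr.
have abF := leq_trans ab cF; rewrite leqNgt abF /=.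
have [Q sQ cQ] : exists2 Q : {set _}, Q \subset F' :\: phi @: setT & #|Q| = a + b - #|S|.
  by apply: subset_of_card; lia.
have Qphi x : phi x \notin Q.
  by apply/negP=> /(subsetP sQ); rewrite inE imset_f.
have dQ : phi @: S :&: Q = set0.
  apply/setP=> y; rewrite !inE; apply/negP=> /andP[/imsetP[x _ ->]].
  by apply/negP.
have cS' : #|phi @: S :|: Q| = a + b.
  by rewrite cardsU dQ cards0 subn0 card_imset // cQ subnKC.
apply/existsP; exists (phi @: S :|: Q); rewrite cS' eqxx /= subUset.
rewrite (subset_trans (imsetS _ sS) sF) (subset_trans sQ (subsetDl _ _)) /=.
apply/forallP=> D'; apply/implyP=> /andP[sD' /eqP cD'].
(* Only [a + b - #|S|] of the offered vertices are padding, so at least [#|S| - b] of Client's [a]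
   vertices lie in [S]; [D] keeps exactly that many and forgets the others. *)
have [D sD cD] : exists2 D : {set _}, D \subset phi @^-1: D' :&: S & #|D| = #|S| - b.
  apply: subset_of_card; rewrite -[X in _ <= X](card_imset _ phi_inj).
  have sub : D' \subset phi @: (phi @^-1: D' :&: S) :|: Q.
    apply/subsetP=> y yD; have := subsetP sD' _ yD; rewrite !inE.
    case/orP=> [/imsetP[x xS ex]|->]; last by rewrite orbT.
    by rewrite ex imset_f //= !inE -ex yD.
  set X := #|_ @: _|; suff : a <= X + (a + b - #|S|) by clear -cS; lia.
  by rewrite -cQ -cD'; apply: leq_trans (subset_leq_card sub) (leq_card_setU _ _).
have sDS := subset_trans sD (subsetIr _ _).
apply: (IH _ (F :\: S) (C :|: D)) => //.
- by have := wS D; rewrite sDS cD eqxx.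
- apply/subsetP=> y /imsetP[x]; rewrite !inE => /andP[xS xF] ->.
  by rewrite negb_or mem_imset // xS Qphi (subsetP sF) // imset_f.
- rewrite imsetU; apply: setUSS => //; apply/subsetP=> y /imsetP[x xD ->].
  by have := subsetP sD _ xD; rewrite !inE => /andP[].
- have -> : (F' :\: (phi @: S :|: Q)) :\: phi @: setT = (F' :\: phi @: setT) :\: Q.
    apply/setP=> y; rewrite !inE; case yQ: (y \in Q); rewrite ?orbT ?andbF //=.
    case yT: (y \in phi @: setT) => //=; rewrite orbF.
    by case yS: (y \in phi @: S) => //; rewrite (subsetP (imsetS _ (subsetT S)) y yS) in yT.
  by rewrite cardsDS // cQ; lia.
- have step x : a + b < x -> x < m.+1 -> x - (a + b) < m by clear -a0; lia.
  rewrite cardsDS ?cS'; first exact: step.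
  by rewrite subUset (subset_trans (imsetS _ sS) sF) (subset_trans sQ (subsetDl _ _)).
Qed.

(* Client answers an offer [S'] as on the board, completing his choice with
   vertices outside the blocks. *)
Lemma extend_choice (S' : {set 'I_n}) (D : {set I * 'I_k}) :
  D \subset phi @^-1: S' -> #|D| = #|phi @^-1: S'| - b ->
  exists2 D' : {set 'I_n}, D' \subset S' & #|D'| = #|S'| - b /\ phi @^-1: D' = D.
Proof.
move=> sD cD.
have sD' : phi @: D \subset S'.
  by apply/subsetP=> y /imsetP[x /(subsetP sD)]; rewrite inE => ? ->.
have sT' : phi @: (phi @^-1: S') \subset S'.
  by apply/subsetP=> y /imsetP[x]; rewrite inE => ? ->.
have cc := cardsDS sT'; rewrite card_imset // in cc.
have le := subset_leq_card sT'; rewrite card_imset // in le.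
have [Q sQ cQ] : exists2 Q : {set _}, Q \subset S' :\: phi @: (phi @^-1: S')
    & #|Q| = #|S'| - b - #|D|.
  apply: subset_of_card; rewrite cc cD; clear -le.
  by move: #|S'| #|_ @^-1: _| le => s t le; lia.
have Qphi x : phi x \notin Q.
  by apply/negP=> /(subsetP sQ); rewrite !inE mem_imset // inE andNb.
have dQ : phi @: D :&: Q = set0.
  apply/setP=> y; rewrite !inE; apply/negP=> /andP[/imsetP[x _ ->]].
  by apply/negP.
exists (phi @: D :|: Q); last split.
- by rewrite subUset sD' (subset_trans sQ (subsetDl _ _)).
- rewrite cardsU dQ cards0 subn0 card_imset // cQ cD; clear -le.
  by move: #|S'| #|_ @^-1: _| le => s t le; lia.
- by apply/setP=> x; rewrite !inE mem_imset // (negbTE (Qphi x)) orbF.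
Qed.

(** Waiter's offers pull back along [phi] to board offers. Every copy of H contains a whole block,
    so the copy that Client ends up with fills a block. *)
Lemma ww_board_win fuel (F' C' : {set 'I_n}) :
  (forall C (f : {ffun 'I_k -> 'I_n}), embeds EH EG C f -> exists t, forall x, phi (t, x) \in C) ->
  ww EH EG a b fuel F' C' ->
  board_win a b fuel (phi @^-1: F') (phi @^-1: C').
Proof.
move=> blk.
have fullH C : hasH EH EG C -> full_block (phi @^-1: C).
  case/existsP=> f /blk[t tC]; apply/existsP; exists t; apply/forallP=> x.
  by rewrite inE.
elim: fuel F' C' => [|fuel IH] F' C' /=; first by rewrite orbF => /fullH.
case: leqP => [leF /forallP w|ltF /existsP[S' /and3P[sS /eqP cS /forallP w]]].
all: apply/orP; right; apply/existsP.
  (* The last round turns into one board offer of all the free block vertices. *)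
  have cF : #|phi @^-1: F'| <= #|F'|.
    rewrite -(card_imset _ phi_inj); apply/subset_leq_card/subsetP=> y.
    by case/imsetP=> x; rewrite inE => ? ->.
  exists (phi @^-1: F'); rewrite subxx (leq_trans cF) //=.
  apply/forallP=> D; apply/implyP=> /andP[sD /eqP cD].
  have [D' sD' [cD' eD']] := extend_choice sD cD.
  have := w D'; rewrite sD' cD' eqxx /= => /fullH.
  by rewrite preimsetU eD' => /board_win_full; apply.
have cF : #|phi @^-1: S'| <= #|S'|.
  rewrite -(card_imset _ phi_inj); apply/subset_leq_card/subsetP=> y.
  by case/imsetP=> x; rewrite inE => ? ->.
exists (phi @^-1: S'); rewrite preimsetS //= -{1}cS cF /=.
apply/forallP=> D; apply/implyP=> /andP[sD /eqP cD].
have [D' sD' [cD' eD']] := extend_choice sD cD.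
have := w D'; rewrite sD' cD' cS addnK eqxx /= => /IH.
by rewrite preimsetU preimsetD eD'.
Qed.

End WaiterClient.

(** * Waiter's win on [(b + 1) ^ k] blocks *)

Section WaiterBoardStrategy.
Variables (a b k : nat) (I : finType).
Hypothesis a0 : 0 < a.

(* Each offer of one fresh vertex in [b + 1] blocks forces Client to advance in
   one of them, so the number of live blocks shrinks by a factor [b + 1] per level. *)
Lemma board_win_levels j (A : {set I}) (F C : {set I * 'I_k}) :
  j <= k -> #|A| = b.+1 ^ j ->
  (forall t (x : 'I_k), t \in A -> if x < k - j then (t, x) \in C else (t, x) \in F) ->
  exists fuel, board_win a b fuel F C.
Proof.
(* Passing from level [j.+1] to level [j] takes [b.+1 ^ j] offers; [fu] adds them up. *)
pose fu := fix fu j := if j is j'.+1 then b.+1 ^ j' + fu j' else 0.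
move=> jk cA lv; exists (fu j); elim: j A F C jk cA lv => [|j IH] A F C jk cA lv.
  apply: board_win_full; have /card_gt0P[t tA] : 0 < #|A| by rewrite cA.
  apply/existsP; exists t; apply/forallP=> x.
  by have := lv t x tA; rewrite subn0 ltn_ord.
(* Invariant inside one level: [A] holds the blocks not yet offered, [B] those in which Client has
   already advanced, and [c] counts the offers still to be made. *)
have [c [B [cAc cBc]]] : exists c (B : {set I}), [/\ #|A| = b.+1 * c, #|B| + c = b.+1 ^ j,
     [disjoint A & B] & c + fu j = fu j.+1 /\
     forall t (x : 'I_k), t \in B -> if x < k - j then (t, x) \in C else (t, x) \in F].
  exists (b.+1 ^ j), set0; split; rewrite ?cA ?expnS ?cards0 //.
    by rewrite disjoint_sym disjoints_subset sub0set.
  by split=> // t x; rewrite inE.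
move=> dAB [<-]; elim: c A B F C cAc cBc dAB lv {cA} => [|c IHc] A B F C cA cB dAB lv lvB.
  by apply: IH lvB; [exact: ltnW | rewrite -cB addn0].
have [S0 sS0 cS0] : exists2 S0 : {set _}, S0 \subset A & #|S0| = b.+1.
  by apply: subset_of_card; rewrite cA leq_pmulr.
(* The vertices of a block are offered in the order of their indices; with [j.+1] of them missing,
   the next one has index [k - j.+1]. *)
have x0k : k - j.+1 < k by lia.
pose x0 := Ordinal x0k; rewrite addSn /=; apply/orP; right; apply/existsP.
exists [set (t, x0) | t in S0]; have pi : injective (fun t : I => (t, x0)) by move=> ? ? [].
rewrite card_imset // cS0; apply/and3P; split; last 1 first.
(* An offer of [b.+1] vertices forces Client to take exactly one. *)
- apply/forallP=> D; rewrite -addn1 addKn; apply/implyP=> /andP[sD /cards1P[p eD]].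
  have : p \in D by rewrite eD inE.
  move/(subsetP sD)=> /imsetP[t tS ep]; rewrite {}ep in eD.
  have tA := subsetP sS0 _ tS.
  have tB : t \notin B by rewrite (disjointFr dAB).
  apply: (IHc (A :\: S0) (t |: B)).
  + by rewrite cardsDS // cA cS0; lia.
  + by rewrite cardsU1 tB; lia.
  + rewrite -setI_eq0; apply/eqP/setP=> u; rewrite !inE.
    case: eqP => [->|_] /=; first by rewrite tS.
    by case uA: (u \in A); rewrite ?andbF //= (disjointFr dAB uA) andbF.
  + move=> u x; rewrite !inE => /andP[uS uA]; have := lv u x uA.
    case: ifP => [_ -> //|_ ->]; rewrite andbT; apply/imsetP=> -[v vS [uv _]].
    by rewrite uv vS in uS.
  + move=> u x; case/setU1P=> [->{u}|uB].
      have := lv t x tA; rewrite eD !inE !xpair_eqE eqxx /=.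
      have [xlt|xge] := ltnP x (k - j.+1).
        by move=> ->; case: ifP => // /negP[]; lia.
      case: ifP => [xlt' _|xnlt ->]; last first.
        rewrite andbT; apply/imsetP=> -[v vS [_ xx]].
        by rewrite xx /= in xnlt; lia.
      by apply/orP; right; apply/eqP/val_inj => /=; lia.
    have := lvB u x uB; rewrite !inE; case: ifP => [_ -> //|_ ->].
    rewrite andbT; apply/imsetP=> -[v vS [uv _]].
    by rewrite -uv in vS; rewrite (disjointFr dAB (subsetP sS0 _ vS)) in uB.
- apply/subsetP=> p /imsetP[t tS ->]; have := lv t x0 (subsetP sS0 _ tS).
  by rewrite /= ltnn.
- lia.
Qed.

End WaiterBoardStrategy.

Definition board_winnable (a b k r : nat) : Prop :=
  exists fuel, board_win a b fuel [set: 'I_r * 'I_k] set0.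

Lemma board_winnable_exp a b k : 0 < a -> board_winnable a b k (b.+1 ^ k).
Proof.
move=> a0; apply: (@board_win_levels a b k _ a0 k [set: 'I_(b.+1 ^ k)]) => //.
  by rewrite cardsT card_ord.
by move=> t x _; rewrite subnn ltn0 inE.
Qed.

Lemma WaiterWin_of_blocks a b k r :
  0 < a -> board_winnable a b k r ->
  exists n0, forall n (EH : {set {set 'I_k}}) (EG : {set {set 'I_n}}) (phi : 'I_r * 'I_k -> 'I_n),
    n0 <= n -> injective phi ->
    (forall t, embeds EH EG setT [ffun x => phi (t, x)]) -> WaiterWin EH a b EG.
Proof.
(* Room for the [r * k] block vertices and for more than [fuel * (a + b)] padding vertices. *)
move=> a0 [fuel w]; exists (fuel * (a + b) + r * k).+1 => n EH EG phi n0n phi_inj emb.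
apply: (board_win_ww phi_inj emb w); rewrite ?imset0 ?sub0set ?subsetT //; last first.
  by rewrite cardsT card_ord.
rewrite cardsDS ?subsetT // card_imset // !cardsT card_prod !card_ord; lia.
Qed.

(** * Disjoint copies of H as blocks of the board *)

Definition disjoint_copies k n (EH : {set {set 'I_k}}) (EG : {set {set 'I_n}}) : bool :=
  [forall c in copies EH EG, forall c' in copies EH EG, (c != c') ==> [disjoint c.1 & c'.1]].

(** One embedding is chosen for each of [r] copies; disjointness makes them jointly injective. If
    [r] counts all copies, any embedding has one of the blocks as its image, which is what
    [ww_board_win] asks for. *)
Lemma copies_blocks k n (EH : {set {set 'I_k}}) (EG : {set {set 'I_n}}) r :
  disjoint_copies EH EG -> r <= #|copies EH EG| ->
  exists phi : 'I_r * 'I_k -> 'I_n,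
    [/\ injective phi, forall t, embeds EH EG setT [ffun x => phi (t, x)] &
        r = #|copies EH EG| ->
        forall C (f : {ffun 'I_k -> 'I_n}), embeds EH EG C f ->
          exists t, forall x, phi (t, x) \in C].
Proof.
move=> /forall_inP dis rc; pose c (t : 'I_r) := enum_val (widen_ord rc t).
have cc t : c t \in copies EH EG by apply: enum_valP.
have c_inj : injective c.
  by move=> t u /enum_val_inj /(congr1 val) /= /val_inj.
have /fin_all_exists[f fP] (t : 'I_r) : exists f : {ffun 'I_k -> 'I_n},
    embeds EH EG setT f /\ (c t).1 = f @: setT.
  by have /imsetP[f] := cc t; rewrite inE => fe ->; exists f.
have inc t x : f t x \in (c t).1 by rewrite (fP t).2 imset_f.
exists (fun p => f p.1 p.2); split.
- move=> [t x] [u y] /= e.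
  have tu : t = u.
    apply: c_inj; apply/eqP; case: (boolP (c t == c u)) => // ne.
    have /forall_inP /(_ _ (cc u)) := dis _ (cc t); rewrite ne /= => d.
    by have := disjointFr d (inc t x); rewrite e inc.
  by move: e; rewrite -tu; have [/embedsP[fi _ _] _] := fP t => /fi ->.
- move=> t; have [fe _] := fP t; rewrite [X in embeds _ _ _ X](_ : _ = f t) //.
  by apply/ffunP=> x; rewrite ffunE.
move=> er C g /embedsP[gi gC ge].
pose cg : {set 'I_n} * {set {set 'I_n}} := (g @: setT, (fun e : {set 'I_k} => g @: e) @: EH).
have cgc : cg \in copies EH EG.
  by apply/imsetP; exists g => //; rewrite inE; apply/embedsP; split=> // x; rewrite inE.
have ltr : enum_rank_in cgc cg < r by rewrite er.
exists (Ordinal ltr) => x.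
have ect : c (Ordinal ltr) = cg.
  rewrite -[RHS](enum_rankK_in cgc cgc) /c; congr (enum_val _); exact: val_inj.
have := inc (Ordinal ltr) x; rewrite ect => /imsetP[y _ ->]; exact: gC.
Qed.

Lemma ex_least (P : nat -> Prop) n : P n -> exists m, P m /\ forall i, i < m -> ~ P i.
Proof.
elim/ltn_ind: n => n IH Pn; case: (classic (exists2 i, i < n & P i)) => [[i /IH]|no].
  exact.
by exists n; split=> // i lin Pi; apply: no; exists i.
Qed.

(* [N] is the least number of disjoint blocks on which Waiter wins. *)
Lemma WaiterWin_copies a b k : 0 < a -> exists N,
  exists n0, forall n (EH : {set {set 'I_k}}) (EG : {set {set 'I_n}}),
    n0 <= n -> disjoint_copies EH EG -> WaiterWin EH a b EG = hasNcopies N EH EG.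
Proof.
move=> a0; have [N [wN minN]] := ex_least (board_winnable_exp b k a0).
have [n0 win] := WaiterWin_of_blocks a0 wN.
exists N, n0 => n EH EG n0n dis; apply/idP/idP.
  (* With fewer than [N] copies, a win on the graph would pull back to a board win on fewer than [N]
     blocks, against minimality. *)
  rewrite /hasNcopies leqNgt => w; apply/negP=> lt.
  have [phi [phi_inj _ blk]] := copies_blocks dis (leqnn _).
  have := ww_board_win phi_inj (blk erefl) w; rewrite preimsetT preimset0 => w'.
  by apply: (minN _ lt); exists n.+1.
by move/(copies_blocks dis) => [phi [phi_inj emb _]]; apply: (win _ _ _ phi).
Qed.

(** Lets one check at a late time of the process cover all earlier times. *)
Lemma disjoint_copiesS k n (EH : {set {set 'I_k}}) (EG EG' : {set {set 'I_n}}) :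
  EG \subset EG' -> disjoint_copies EH EG' -> disjoint_copies EH EG.
Proof.
move=> /subsetP sE /forall_inP dis.
have sub c : c \in copies EH EG -> c \in copies EH EG'.
  move=> /imsetP[f]; rewrite inE => /embedsP[fi _ fe] ->.
  apply/imsetP; exists f => //; rewrite inE; apply/embedsP; split=> [||e eE] //.
    by move=> x; rewrite inE.
  exact/sE/fe.
apply/forall_inP=> c /sub /dis /forall_inP d.
by apply/forall_inP=> c' /sub /d.
Qed.

Lemma hasNcopies_of_blocks k n r (EH : {set {set 'I_k}}) (EG : {set {set 'I_n}})
    (phi : 'I_r * 'I_k -> 'I_n) :
  0 < k -> injective phi -> (forall t, embeds EH EG setT [ffun x => phi (t, x)]) ->
  hasNcopies r EH EG.
Proof.
move=> k0 phi_inj emb; pose x0 := Ordinal k0.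
pose c t := let f := [ffun x => phi (t, x)] in (f @: setT, (fun e : {set 'I_k} => f @: e) @: EH).
have c_inj : injective c.
  move=> t u [/setP /(_ (phi (t, x0)))].
  have -> : phi (t, x0) \in [ffun x => phi (t, x)] @: setT.
    by apply/imsetP; exists x0; rewrite ?ffunE.
  move=> /esym/imsetP[y _]; rewrite ffunE => /phi_inj; by case.
rewrite /hasNcopies -{1}(card_ord r) -(card_codom c_inj).
apply/subset_leq_card/subsetP=> _ /codomP[t ->].
by apply/imsetP; exists [ffun x => phi (t, x)]; rewrite // inE.
Qed.

(** * Power estimates *)

Section PowerBounds.
Local Open Scope R_scope.

Lemma Rpower_nat_unbounded a B : 0 < a ->
  exists n0 : nat, forall n : nat, (n0 <= n)%N -> B < Rpower (INR n) a.
Proof.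
move=> a0; pose B' := Rmax B 1.
have B'0 : 0 < B' by have := Rmax_r B 1; rewrite -/B'; lra.
have [n0 hn0] := INR_unbounded (Rpower B' (/ a)).
exists n0 => n /ssrnat.leP /le_INR le; apply: Rle_lt_trans (Rmax_l B 1) _; rewrite -/B'.
have -> : B' = Rpower (Rpower B' (/ a)) a.
  by rewrite Rpower_mult Rinv_l ?Rpower_1 //; lra.
by apply: Rlt_Rpower_l => //; split; [apply: exp_pos | lra].
Qed.

Lemma Rpower_nat_vanish a B : 0 < a -> 0 < B ->
  exists n0 : nat, forall n : nat, (n0 <= n)%N -> Rpower (INR n) (- a) < B.
Proof.
move=> a0 B0; have [n0 h] := Rpower_nat_unbounded (/ B) a0.
exists n0 => n /h lt; rewrite Rpower_Ropp -(Rinv_inv B); apply: Rinv_lt_contravar => //.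
by apply: Rmult_lt_0_compat; [apply: Rinv_0_lt_compat | apply: exp_pos].
Qed.

Lemma Rpower_powM n x j : Rpower n x ^ j = Rpower n (x * INR j).
Proof. by rewrite -Rpower_pow ?Rpower_mult //; apply: exp_pos. Qed.

Lemma Rpower_le1 n x y : 1 <= n -> x <= y -> Rpower n x <= Rpower n y.
Proof.
move=> n1 xy; case: (Req_dec n 1) => [->|ne]; last by apply: Rle_Rpower; lra.
by rewrite /Rpower ln_1 !Rmult_0_r; apply: Rle_refl.
Qed.

(** The product is at least [lam ^ j * n ^ (w - j / m)], where the exponent of [n] is nonnegative
    and [lam ^ j >= lam] because [j] is positive. This is the density input of the second moment
    method. *)
Lemma dense_power_lb n m lam p j w :
  1 <= n -> 0 < m -> 1 <= lam -> lam * Rpower n (- / m) <= p ->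
  (0 < j)%N -> INR j <= m * INR w -> lam <= p ^ j * n ^ w.
Proof.
move=> n1 m0 lam1 hp j0 jw.
have n0 : 0 < n by lra.
have h0 : 0 <= lam * Rpower n (- / m).
  by apply: Rmult_le_pos; [lra | apply: Rlt_le; apply: exp_pos].
have -> : n ^ w = Rpower n (INR w) by rewrite Rpower_pow.
apply: (Rle_trans _ ((lam * Rpower n (- / m)) ^ j * Rpower n (INR w))); last first.
  apply: Rmult_le_compat_r; first by apply: Rlt_le; apply: exp_pos.
  by apply: pow_incr.
rewrite Rpow_mult_distr Rpower_powM Rmult_assoc -Rpower_plus.
have ge1 : 1 <= Rpower n (- / m * INR j + INR w).
  rewrite -(Rpower_O n n0); apply: Rpower_le1 => //.
  have : INR j / m <= INR w.
    apply: (Rmult_le_reg_l m) => //; apply: (Rle_trans _ (INR j)) => //.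
    by right; field; lra.
  rewrite /Rdiv; lra.
have lamj : lam <= lam ^ j.
  case: j j0 {jw ge1} => // j _ /=; have := pow_R1_Rle lam j lam1; nra.
nra.
Qed.

(** At density exactly [m] the powers of [n] cancel and [lam ^ e] remains. *)
Lemma sparse_power_ub n m lam e v :
  1 <= n -> 0 < m -> 0 <= lam -> lam <= 1 -> (0 < e)%N -> INR e = m * INR v ->
  n ^ v * (lam * Rpower n (- / m)) ^ e <= lam.
Proof.
move=> n1 m0 l0 l1 e0 ev; have n0 : 0 < n by lra.
rewrite -Rpower_pow // Rpow_mult_distr Rpower_powM.
have -> : Rpower n (INR v) * (lam ^ e * Rpower n (- / m * INR e)) =
  lam ^ e * (Rpower n (INR v + - / m * INR e)) by rewrite Rpower_plus; ring.
have -> : INR v + - / m * INR e = 0 by rewrite ev; field; lra.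
rewrite Rpower_O // Rmult_1_r; case: e e0 {ev} => // e _ /=.
have : lam ^ e <= 1 by rewrite -(pow1 e); apply: pow_incr.
have := pow_le lam e l0; nra.
Qed.

(* The process is inspected at density [n ^ (eps - k / e)] with [eps = 1 / (4 e ^ 2)]. *)
Lemma pair_power_ub n p (k e j w : nat) :
  1 <= n -> 0 <= p -> (0 < e)%N -> (j <= e)%N -> (j * k < w * e)%N ->
  p <= 2 * Rpower n (/ (4 * INR e ^ 2) - INR k / INR e) ->
  p ^ (e + (e - j)) * n ^ k.*2 <= 2 ^ e.*2 * Rpower n (- / (2 * INR e)) * n ^ w.
Proof.
move=> n1 p0 e0 je jk hp; have n0 : 0 < n by lra.
have eR : 1 <= INR e by apply: (le_INR 1); apply/ssrnat.leP.
set x := _ - _ in hp; set d := (e + (e - j))%N.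
have dR : INR d = 2 * INR e - INR j.
  by rewrite /d plus_INR minus_INR; [lra | apply/ssrnat.leP].
(* Integrality gives a gap of 1, worth [1 / e] in the exponent; half of it absorbs
   [2 * e * eps = 1 / (2 * e)], and the other half is the gain in the conclusion. *)
have jkR : INR j * INR k + 1 <= INR w * INR e.
  by rewrite -!mult_INR -S_INR; apply: le_INR; apply/ssrnat.leP.
have j0 := pos_INR j; have k0 := pos_INR k.
apply: (Rle_trans _ ((2 * Rpower n x) ^ d * n ^ k.*2)).
  apply: Rmult_le_compat_r; first by apply: pow_le; lra.
  by apply: pow_incr.
rewrite Rpow_mult_distr Rpower_powM -(Rpower_pow k.*2 n) // -(Rpower_pow w n) //.
rewrite !Rmult_assoc -!Rpower_plus.
apply: Rmult_le_compat.
- by apply: pow_le; lra.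
- by apply: Rlt_le; apply: exp_pos.
- rewrite -!Rpower_pow; try lra; apply: Rle_Rpower; first lra.
  by apply: le_INR; apply/ssrnat.leP; rewrite /d -addnn leq_add2l leq_subr.
apply: Rpower_le1 => //; rewrite dR -muln2 mult_INR.
have -> : INR 2 = 2 by [].
rewrite /x.
have e1 : (/ (4 * INR e ^ 2) - INR k / INR e) * (2 * INR e - INR j) + INR k * 2 =
   / (2 * INR e) - INR j / (4 * INR e ^ 2) + (INR j * INR k) / INR e by field; lra.
rewrite e1.
have a1 : 0 <= INR j / (4 * INR e ^ 2).
  by apply: Rle_mult_inv_pos => //; nra.
have a2 : (INR j * INR k) / INR e <= INR w - / INR e.
  apply: (Rmult_le_reg_r (INR e)); first lra.
  have -> : INR j * INR k / INR e * INR e = INR j * INR k by field; lra.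
  have -> : (INR w - / INR e) * INR e = INR w * INR e - 1 by field; lra.
  lra.
have a3 : / INR e = / (2 * INR e) + / (2 * INR e) by field; lra.
lra.
Qed.

Lemma ex_nat_between x : 1 <= x -> exists m : nat, x <= INR m <= 2 * x.
Proof.
move=> x1; have [h1 h2] := archimed x.
have u0 : Z.le Z0 (up x) by apply: le_IZR; lra.
exists (Z.to_nat (up x)); rewrite INR_IZR_INZ Z2Nat.id //; lra.
Qed.

End PowerBounds.

Import Order.TTheory GRing.Theory Num.Theory.

(** * First and second moments in random graphs *)

Module RandomGraphs.
Import mathcomp.algebra_tactics.ring mathcomp.algebra_tactics.lra.
Local Open Scope ring_scope.

(** * Weighted sums as probabilities: union bound and Chebyshev's inequality *)

Section FiniteProbability.
Variables (R : realFieldType) (T : Type) (r : seq T) (w : T -> R).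
Hypothesis w_ge0 : forall x, 0 <= w x.

Definition Pr (P : pred T) : R := \sum_(x <- r | P x) w x.

Lemma Pr_mono (P Q : pred T) : (forall x, P x -> Q x) -> Pr P <= Pr Q.
Proof.
move=> PQ; rewrite /Pr !(big_mkcond P) !(big_mkcond Q) /=; apply: ler_sum => x _.
by case: ifP => [/PQ -> //|_]; case: ifP.
Qed.

Lemma Pr_union (I : finType) (A : pred I) (Q : I -> pred T) (P : pred T) :
  (forall x, P x -> exists2 i, A i & Q i x) -> Pr P <= \sum_(i | A i) Pr (Q i).
Proof.
move=> PQ.
rewrite (eq_bigr (fun i => \sum_(x <- r) if Q i x then w x else 0)); last first.
  by move=> i _; rewrite /Pr big_mkcond.
rewrite exchange_big /Pr big_mkcond /=; apply: ler_sum => x _.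
have ge0 i : 0 <= if Q i x then w x else 0 by case: ifP.
case: ifP => [/PQ[i Ai Qi]|_]; last exact: sumr_ge0.
by rewrite (bigD1 i) //= Qi lerDl sumr_ge0.
Qed.

(** Chebyshev's inequality without division: on the event [X x = 0] the variance summand
    [(X x - mu) ^+ 2] equals [mu ^+ 2]. *)
Lemma Pr_eq0_second_moment (X : T -> R) (mu m2 : R) :
  Pr predT = 1 -> \sum_(x <- r) w x * X x = mu -> \sum_(x <- r) w x * X x ^+ 2 = m2 ->
  Pr (fun x => X x == 0) * mu ^+ 2 <= m2 - mu ^+ 2.
Proof.
move=> w1 emu em2.
have -> : m2 - mu ^+ 2 = \sum_(x <- r) w x * (X x - mu) ^+ 2.
  rewrite (eq_bigr (fun x => w x * X x ^+ 2 +
    ((w x * X x) * (- 2 * mu) + w x * mu ^+ 2))); last by move=> x _; ring.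
  by rewrite !big_split -!big_distrl /= em2 emu -/(Pr predT) w1; ring.
rewrite /Pr big_distrl big_mkcond /=; apply: ler_sum => x _.
case: ifP => [/eqP ->|_]; first by rewrite sub0r sqrrN.
by rewrite mulr_ge0 // sqr_ge0.
Qed.

End FiniteProbability.

Lemma Pr_subU (R : realFieldType) (T : eqType) (r : seq T) (w : T -> R) (P Q Q' : pred T) :
  (forall x, 0 <= w x) -> (forall x, x \in r -> P x -> Q x || Q' x) ->
  Pr r w P <= Pr r w Q + Pr r w Q'.
Proof.
move=> w0 sub; rewrite /Pr !(big_mkcond P) !(big_mkcond Q) !(big_mkcond Q') -!big_split /=.
rewrite big_seq [X in _ <= X]big_seq; apply: ler_sum => x xr.
have := sub x xr; have := w0 x.
by case: (P x) (Q x) (Q' x) => -[] [] //=; rewrite ?addr0 ?add0r; lra.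
Qed.

(** * Products of nonincreasing edge probabilities *)

Section FallingProduct.
Variables (R : realFieldType) (u : nat -> R).
Hypotheses (u_ge0 : forall i, 0 <= u i) (u_noninc : forall i, u i.+1 <= u i).

(** Stands for the probability that [j] given edges are present, [u i] being the conditional
    probability of one more edge after [i] of them. *)
Definition prefix_prod (j : nat) : R := \prod_(i < j) u i.

Lemma nonincr_le i j : (i <= j)%N -> u j <= u i.
Proof.
by move=> /subnK <-; elim: (j - i)%N => //= d IH; rewrite addSn (le_trans (u_noninc _)).
Qed.

Lemma prefix_prod_ge0 j : 0 <= prefix_prod j.
Proof. by apply: prodr_ge0. Qed.

Lemma prefix_prod_le j : prefix_prod j <= u 0 ^+ j.
Proof.
rewrite /prefix_prod -[X in u 0 ^+ X]card_ord -prodr_const.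
by apply: ler_prod => i _; rewrite u_ge0 nonincr_le.
Qed.

Lemma prefix_prodD i j : prefix_prod (i + j) = prefix_prod i * \prod_(l < j) u (i + l)%N.
Proof. by rewrite /prefix_prod big_split_ord. Qed.

(** Negative correlation of disjoint edge sets. *)
Lemma prefix_prod_subM i j : prefix_prod (i + j) <= prefix_prod i * prefix_prod j.
Proof.
rewrite prefix_prodD ler_wpM2l ?prefix_prod_ge0 //; apply: ler_prod => l _.
by rewrite u_ge0 nonincr_le // leq_addl.
Qed.

(** For two copies with [j] common edges: after trading [u 0] for [c * u e], the [j] factors [u e]
    complete [prefix_prod (e - j)] to at most [prefix_prod e]. *)
Lemma prefix_prod_overlap e j c : 0 <= c -> u 0 <= c * u e -> (j <= e)%N ->
  u 0 ^+ j * prefix_prod (e + (e - j)) <= c ^+ j * prefix_prod e ^+ 2.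
Proof.
move=> c0 uc je.
have h : prefix_prod (e - j) * u e ^+ j <= prefix_prod e.
  rewrite -{3}(subnK je) prefix_prodD ler_wpM2l ?prefix_prod_ge0 //.
  rewrite -[X in _ ^+ X]card_ord -prodr_const; apply: ler_prod => i _.
  by rewrite u_ge0 nonincr_le //; have := ltn_ord i; lia.
have h1 : u 0 ^+ j <= c ^+ j * u e ^+ j by rewrite -exprMn lerXn2r ?nnegrE ?mulr_ge0.
apply: le_trans (ler_wpM2l (exprn_ge0 _ (u_ge0 0)) (prefix_prod_subM _ _)) _.
apply: le_trans (ler_wpM2r (mulr_ge0 (prefix_prod_ge0 _) (prefix_prod_ge0 _)) h1) _.
rewrite [X in X <= _](_ : _ = c ^+ j * prefix_prod e * (prefix_prod (e - j) * u e ^+ j));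
  last by ring.
by rewrite expr2 [X in _ <= X]mulrA ler_wpM2l // mulr_ge0 ?exprn_ge0 ?prefix_prod_ge0.
Qed.

End FallingProduct.

(** * Images of a pattern under vertex maps, and their overlaps *)

Section Patterns.
Variables (n : nat) (V : finType) (E : {set {set V}}).
Implicit Types f g : {ffun V -> 'I_n}.

Definition im_edges f : {set {set 'I_n}} := (fun e : {set V} => f @: e) @: E.
Definition meet_vertices f g : {set V} := [set x | g x \in f @: setT].

Lemma im_edges_pairs f :
  (forall e, e \in E -> #|e| = 2) -> injective f -> im_edges f \subset pairs n.
Proof.
move=> E2 fi; apply/subsetP=> _ /imsetP[e eE ->].
by rewrite inE card_imset // E2.
Qed.

Lemma card_im_edges f : injective f -> #|im_edges f| = #|E|.
Proof. by move=> fi; rewrite card_imset //; apply: imset_inj. Qed.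

Lemma card_im_edgesU f g : injective f -> injective g ->
  #|im_edges f :|: im_edges g| = (#|E| + (#|E| - #|im_edges f :&: im_edges g|))%N.
Proof.
move=> fi gi; rewrite cardsU !card_im_edges // addnBA //.
by rewrite -(card_im_edges fi) subset_leq_card ?subsetIl.
Qed.

Lemma card_im_edgesI f g : injective g ->
  #|im_edges f :&: im_edges g| =
  #|[set e in E | g @: e \in im_edges f]|.
Proof.
move=> gi; rewrite -(card_imset _ (imset_inj gi)); apply: eq_card => y.
rewrite !inE; apply/andP/imsetP => [[yf /imsetP[e eE ey]]|[e]].
  by exists e; rewrite // !inE eE -ey.
by rewrite !inE => /andP[eE ef] ->; split=> //; apply: imset_f.
Qed.

Lemma common_edge_sub f g (e : {set V}) :
  g @: e \in im_edges f -> e \subset meet_vertices f g.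
Proof.
move=> /imsetP[e' e'E ee]; apply/subsetP=> x xe; rewrite inE.
have : g x \in g @: e by apply: imset_f.
by rewrite ee => /imsetP[y _ ->]; apply: imset_f.
Qed.

(* The weight [n ^ #|meet_vertices f g|] compensates the loss of freedom of
   [g] on the vertices it shares with [f]. *)
Lemma sum_meet_vertices f :
  (\sum_g n ^ #|meet_vertices f g| <= (#|V|.+1 * n) ^ #|V|)%N.
Proof.
have e g : (n ^ #|meet_vertices f g| = \prod_x if g x \in f @: setT then n else 1)%N.
  rewrite -big_mkcond /= prod_nat_const; congr (n ^ _)%N.
  by apply: eq_card => x; rewrite !inE.
under eq_bigr => g _ do rewrite e.
rewrite -(bigA_distr_bigA (fun _ y => if y \in f @: setT then n else 1%N)) /=.
have -> c : (c ^ #|V| = \prod_(x : V) c)%N by rewrite -prod_nat_const; apply: eq_bigl.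
apply: leq_prod => x _; rewrite mulSn addnC.
have -> : (\sum_y (if y \in f @: setT then n else 1) =
          \sum_(y in f @: setT) n + \sum_(y | y \notin f @: setT) 1)%N.
  by rewrite (bigID (mem (f @: setT))) /=; congr addn;
    apply: eq_bigr => y; [move=> -> | move/negbTE => ->].
rewrite sum_nat_const leq_add ?leq_mul2r //.
  by rewrite (leq_trans (leq_imset_card _ _)) ?cardsT ?orbT.
by rewrite sum1_card (leq_trans (max_card _)) ?card_ord.
Qed.

Lemma card_injective_ffun : #|[pred f : {ffun V -> 'I_n} | injectiveb f]| = n ^_ #|V|.
Proof.
by rewrite -[X in X ^_ _](card_ord n) -card_inj_ffuns; apply: eq_card => f; rewrite !inE.
Qed.

Lemma expn_le_ffact : (#|V|.*2 <= n)%N -> (n ^ #|V| <= 2 ^ #|V| * n ^_ #|V|)%N.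
Proof.
have pw c : (c ^ #|V| = \prod_(i < #|V|) c)%N by rewrite big_const_ord iter_muln_1.
move=> le; rewrite ffact_prod !pw -big_split /=; apply: leq_prod => i _.
suff : (i.*2 <= n)%N by lia.
by apply: leq_trans le; rewrite leq_double ltnW.
Qed.

End Patterns.

(* [G(n, p)] is the case [u i = p], and the uniform graph with [m] out of [M]
   edges is the case [u i = (m - i) / (M - i)]. *)
Section RandomGraph.
Variables (R : realFieldType) (T : Type) (r : seq T) (w : T -> R).
Variables (n : nat) (G : T -> {set {set 'I_n}}) (u : nat -> R).
Hypotheses (w_ge0 : forall x, 0 <= w x) (u_ge0 : forall i, 0 <= u i).
Hypothesis u_noninc : forall i, u i.+1 <= u i.
Hypothesis Pr_edges : forall A : {set {set 'I_n}}, A \subset pairs n ->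
  Pr r w (fun x => A \subset G x) = prefix_prod u #|A|.

Lemma Pr_total : Pr r w predT = 1.
Proof.
have := Pr_edges (sub0set _); rewrite cards0 /prefix_prod big_ord0 => <-.
by apply: eq_bigl => x; rewrite sub0set.
Qed.

Lemma Pr_le1 (P : pred T) : Pr r w P <= 1.
Proof. by rewrite -Pr_total; apply: Pr_mono. Qed.

Lemma PrC (P : pred T) : Pr r w P = 1 - Pr r w (fun x => ~~ P x).
Proof. by rewrite -Pr_total {2}/Pr (bigID P) /= /Pr addrK. Qed.

Section Pattern.
Variables (V : finType) (E : {set {set V}}).
Hypothesis E2 : forall e, e \in E -> #|e| = 2.

Definition has_pattern (x : T) : bool :=
  [exists f : {ffun V -> 'I_n}, injectiveb f && (im_edges E f \subset G x)].

(** Second moment method for the number [X] of injective maps sending the pattern into the graph.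
    The variance is at most the squared mean times the right-hand side, so Chebyshev's inequality
    applies. *)
Lemma Pr_no_pattern (lam c : R) :
  0 < lam -> 1 <= c -> (#|V|.*2 <= n)%N -> u 0 <= c * u #|E| ->
  (forall (W : {set V}) j, (0 < j <= #|[set e in E | e \subset W]|)%N ->
     lam <= u 0 ^+ j * n%:R ^+ #|W|) ->
  Pr r w (fun x => ~~ has_pattern x) <= c ^+ #|E| * (2 * #|V|.+1%:R) ^+ #|V| / lam.
Proof.
move=> lam0 c1 Vn uc hlam.
pose inj := [pred f : {ffun V -> 'I_n} | injectiveb f].
pose X x : R := \sum_(f in inj) (im_edges E f \subset G x)%:R.
pose L : R := #|inj|%:R; pose q := prefix_prod u #|E|.
have c0 : 0 < c by apply: lt_le_trans c1.
(* Otherwise the density hypothesis for the whole vertex set would give [lam <= 0]. *)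
have u0ge j : (0 < j <= #|E|)%N -> 0 < u 0.
  move=> jE; rewrite lt_def u_ge0 andbT; apply/negP=> /eqP u00.
  have := hlam setT j; rewrite u00 expr0n.
  have -> : [set e in E | e \subset [set: V]] = E by apply/setP=> e; rewrite inE subsetT andbT.
  move=> /(_ jE); case: j jE => // j _; rewrite mul0r => h.
  by have := lt_le_trans lam0 h; rewrite ltxx.
have q0 : 0 < q.
  rewrite /q /prefix_prod; apply: prodr_gt0 => i _.
  have u0 : 0 < u 0 by apply: (u0ge #|E|); rewrite leqnn andbT (leq_ltn_trans _ (ltn_ord i)).
  have : 0 < c * u #|E| by apply: lt_le_trans uc.
  rewrite pmulr_rgt0 // => /lt_le_trans; apply.
  by apply: nonincr_le => //; apply: ltnW.
have EI (A : {set {set 'I_n}}) : A \subset pairs n ->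
    \sum_(x <- r) w x * (A \subset G x)%:R = prefix_prod u #|A|.
  move=> sA; rewrite -Pr_edges // /Pr [RHS]big_mkcond /=; apply: eq_bigr => x _.
  by case: ifP; rewrite ?mulr1 ?mulr0.
have injP f : f \in inj -> injective f by rewrite inE => /injectiveP.
have EX : \sum_(x <- r) w x * X x = L * q.
  under eq_bigr => x _ do rewrite /X big_distrr /=.
  rewrite exchange_big /=.
  rewrite (eq_bigr (fun=> q)); last first.
    move=> f fi; rewrite EI; last by apply: im_edges_pairs => //; apply: injP.
    by rewrite card_im_edges //; apply: injP.
  by rewrite sumr_const mulr_natl.
have EX2 : \sum_(x <- r) w x * X x ^+ 2 =
    \sum_(f in inj) \sum_(g in inj) prefix_prod u #|im_edges E f :|: im_edges E g|.
  transitivity (\sum_(x <- r) \sum_(f in inj) \sum_(g in inj)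
      w x * (im_edges E f :|: im_edges E g \subset G x)%:R).
    apply: eq_bigr => x _; rewrite expr2 /X big_distrlr big_distrr /=.
    apply: eq_bigr => f _; rewrite big_distrr /=; apply: eq_bigr => g _.
    by rewrite subUset; case: (_ \subset _); case: (_ \subset _); rewrite ?mulr1 ?mulr0.
  rewrite exchange_big; apply: eq_bigr => f fi /=.
  rewrite exchange_big; apply: eq_bigr => g gi /=.
  by rewrite EI // subUset !im_edges_pairs //; apply: injP.
(* Covariance of two copies. Without common edges it is at most 0; otherwise the overlap bound costs
   [u 0 ^+ j], and the density hypothesis on the vertices that [g] shares with [f] pays for it. *)
have bnd f g : f \in inj -> g \in inj ->
    prefix_prod u #|im_edges E f :|: im_edges E g| - q ^+ 2 <=
    q ^+ 2 * c ^+ #|E| / lam * (n ^ #|meet_vertices f g|)%:R.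
  move=> /injP fi /injP gi; rewrite card_im_edgesU //.
  set j := #|_ :&: _|.
  have [j0|j0] := posnP j.
    rewrite j0 subn0.
    have := prefix_prod_subM u_ge0 u_noninc #|E| #|E|; rewrite -/q -expr2 => h.
    apply: (@le_trans _ _ 0); first by rewrite subr_le0.
    by rewrite !mulr_ge0 ?exprn_ge0 ?invr_ge0 ?ler0n ?ltW.
  have jE : (j <= #|E|)%N.
    by rewrite -(card_im_edges E fi) subset_leq_card ?subsetIl.
  have ov := prefix_prod_overlap u_ge0 u_noninc (ltW c0) uc jE.
  have jW : (j <= #|[set e in E | e \subset meet_vertices f g]|)%N.
    rewrite /j card_im_edgesI //; apply/subset_leq_card/subsetP=> e.
    by rewrite !inE => /andP[-> /common_edge_sub].
  have hl := hlam (meet_vertices f g) j; rewrite j0 jW in hl; have {}hl := hl isT.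
  have u0 : 0 < u 0 by apply: (u0ge j); rewrite j0.
  have uj : 0 < u 0 ^+ j by rewrite exprn_gt0.
  apply: (@le_trans _ _ (prefix_prod u (#|E| + (#|E| - j)))).
    by rewrite gerBl sqr_ge0.
  rewrite -(ler_pM2l uj); apply: le_trans ov _.
  have cj : c ^+ j <= c ^+ #|E| by rewrite ler_weXn2l.
  apply: le_trans (ler_wpM2r (sqr_ge0 _) cj) _.
  have re (x y z t : R) : x * (y * z / lam * t) = (z * y) * (x * t / lam) by ring.
  rewrite natrX re.
  rewrite -/q ler_peMr ?mulr_ge0 ?exprn_ge0 ?sqr_ge0 ?(ltW c0) ?(ltW q0) //.
  by rewrite ler_pdivlMr // mul1r.
have sm := Pr_eq0_second_moment w_ge0 Pr_total EX EX2.
have L2 : (L * q) ^+ 2 = \sum_(f in inj) \sum_(g in inj) q ^+ 2.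
  rewrite !sumr_const -[_ *+ _ *+ _]mulr_natl -[q ^+ 2 *+ _]mulr_natl.
  by rewrite -/L exprMn [L ^+ 2]expr2 mulrA.
have n0 : (0 < #|inj|)%N.
  by rewrite /inj card_injective_ffun ffact_gt0; apply: leq_trans Vn; lia.
have L0 : 0 < L by rewrite /L ltr0n.
have Lq : 0 < (L * q) ^+ 2 by rewrite exprn_gt0 // mulr_gt0.
(* Comparing all maps with the injective ones brings the factor [2 ^+ #|V|] of the final bound. *)
have nL : (n ^ #|V|)%:R <= 2 ^+ #|V| * L.
  by rewrite -natrX -natrM ler_nat /inj card_injective_ffun expn_le_ffact.
have tot : \sum_(f in inj) \sum_(g in inj) prefix_prod u #|im_edges E f :|: im_edges E g|
    - (L * q) ^+ 2 <= (L * q) ^+ 2 * (c ^+ #|E| * (2 * #|V|.+1%:R) ^+ #|V| / lam).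
  rewrite L2 -sumrB.
  apply: (@le_trans _ _ (\sum_(f in inj) q ^+ 2 * c ^+ #|E| / lam * ((#|V|.+1 * n) ^ #|V|)%:R)).
    apply: ler_sum => f fi; rewrite -sumrB.
    apply: (@le_trans _ _ (\sum_(g in inj)
        q ^+ 2 * c ^+ #|E| / lam * (n ^ #|meet_vertices f g|)%:R)).
      by apply: ler_sum => g gi; apply: bnd.
    rewrite -big_distrr /= ler_wpM2l
      ?mulr_ge0 ?exprn_ge0 ?invr_ge0 ?(ltW c0) ?(ltW q0) ?(ltW lam0) //.
    rewrite -natr_sum ler_nat; apply: leq_trans (sum_meet_vertices f).
    by rewrite [X in (_ <= X)%N](bigID (mem inj)) /= leq_addr.
  rewrite sumr_const -[_ *+ #|inj|]mulr_natl -/L -L2 expnMn natrM.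
  have re1 (l x y z t : R) : l * (x * y / lam * (z * t)) = (l * x * y / lam * z) * t by ring.
  have re2 (l p y z t : R) : (l * p) ^+ 2 * (y * (t * z) / lam) =
      (l * p ^+ 2 * y / lam * z) * (t * l).
    by ring.
  rewrite [(2 * _) ^+ _]exprMn re1 re2 natrX.
  by rewrite ler_wpM2l // !mulr_ge0 ?exprn_ge0 ?invr_ge0 ?ler0n
    ?(ltW c0) ?(ltW q0) ?(ltW lam0) ?(ltW L0).
rewrite -(ler_pM2r Lq) [X in _ <= X]mulrC.
apply: le_trans tot; apply: le_trans sm.
rewrite ler_wpM2r ?(ltW Lq) //; apply: Pr_mono => // x /existsPn noP.
apply/eqP; rewrite /X big1 // => f fi; have := noP f.
by rewrite [injectiveb f]fi /= => /negbTE ->.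
Qed.

(** Union bound over pairs. By [sum_meet_vertices] the weights [n ^ #|meet_vertices f g|] sum to at
    most [#|V|.+1 ^ #|V| * n ^ #|V|.*2], and the power of [n] cancels against the one in the
    hypothesis. *)
Lemma Pr_pattern_pair (bad : rel {ffun V -> 'I_n}) (mu : R) :
  (0 < n)%N -> 0 <= mu ->
  (forall f g : {ffun V -> 'I_n}, injective f -> injective g -> bad f g ->
     u 0 ^+ #|im_edges E f :|: im_edges E g| * n%:R ^+ #|V|.*2 <=
     mu * n%:R ^+ #|meet_vertices f g|) ->
  Pr r w (fun x => [exists f : {ffun V -> 'I_n}, exists g : {ffun V -> 'I_n},
    [&& injectiveb f, injectiveb g, bad f g & im_edges E f :|: im_edges E g \subset G x]])
  <= mu * #|V|.+1%:R ^+ #|V|.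
Proof.
move=> n0 mu0 hmu.
have nR : 0 < n%:R :> R by rewrite ltr0n.
have nV : 0 < n%:R ^+ #|V|.*2 :> R by rewrite exprn_gt0.
pose FF := ({ffun V -> 'I_n} * {ffun V -> 'I_n})%type.
pose A (p : FF) := [&& injectiveb p.1, injectiveb p.2 & bad p.1 p.2].
pose Q (p : FF) x := im_edges E p.1 :|: im_edges E p.2 \subset G x.
apply: (@le_trans _ _ (\sum_(p | A p) Pr r w (Q p))).
  apply: Pr_union => //.
  move=> x /existsP[f /existsP[g /and4P[fi gi b s]]].
  by exists (f, g); rewrite // /A /= fi gi b.
rewrite -(ler_pM2r nV) big_distrl /=.
apply: (@le_trans _ _ (\sum_(p : FF) mu * (n ^ #|meet_vertices p.1 p.2|)%:R)).
  rewrite big_mkcond; apply: ler_sum => -[f g] _ /=.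
  case: ifP => [/and3P[/injectiveP fi /injectiveP gi b]|_]; last by rewrite mulr_ge0.
  rewrite Pr_edges ?subUset ?im_edges_pairs // natrX.
  apply: le_trans (hmu f g fi gi b); rewrite ler_pM2r //.
  exact: prefix_prod_le.
rewrite -big_distrr /= -mulrA ler_wpM2l // -natr_sum.
rewrite -(pair_big predT predT (fun f g => n ^ #|meet_vertices f g|)%N) /=.
rewrite -natrX -natrX -natrM ler_nat.
apply: (@leq_trans (\sum_(f : {ffun V -> 'I_n}) (#|V|.+1 * n) ^ #|V|)%N).
  by apply: leq_sum => f _; apply: sum_meet_vertices.
rewrite sum_nat_const card_ffun card_ord expnMn mulnCA -expnD addnn.
by rewrite leqnn.
Qed.

End Pattern.

(** First moment. Only the values of a map on [W] matter, so the union bound runs over at most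
    [n ^ #|W|] maps. *)
Lemma Pr_subpattern (V : finType) (W : {set V}) (E : {set {set V}}) :
  (0 < n)%N -> (forall e, e \in E -> #|e| = 2) -> (forall e, e \in E -> e \subset W) ->
  Pr r w (has_pattern E) <= n%:R ^+ #|W| * u 0 ^+ #|E|.
Proof.
move=> n0 E2 EW; pose y0 := Ordinal n0.
(* A map reset to [y0] outside [W] may lose injectivity, so [A] records the two consequences still
   needed: the image edges are as many as in [E], and they are pairs. *)
pose A := [pred f : {ffun V -> 'I_n} |
   (f \in pffun_on y0 (mem W) predT) && (#|im_edges E f| == #|E|)
   && (im_edges E f \subset pairs n)].
apply: (@le_trans _ _ (\sum_(f in A) Pr r w (fun x => im_edges E f \subset G x))).
  apply: Pr_union => //.
  move=> x /existsP[f /andP[/injectiveP fi fG]].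
  pose h := [ffun v => if v \in W then f v else y0].
  have hf : im_edges E h = im_edges E f.
    apply: eq_in_imset => e eE; apply: eq_in_imset => v ve.
    by rewrite ffunE (subsetP (EW e eE)).
  exists h; rewrite ?hf // /A inE /= hf card_im_edges // eqxx im_edges_pairs //= !andbT.
  apply/pffun_onP; split=> //; apply/supportP => v vW.
  by rewrite ffunE (negbTE vW).
apply: (@le_trans _ _ (\sum_(f in A) u 0 ^+ #|E|)).
  apply: ler_sum => f /andP[/andP[_ /eqP <-] fp].
  by rewrite Pr_edges //; apply: prefix_prod_le.
rewrite sumr_const -[_ ^+ _ *+ _]mulr_natl ler_wpM2r ?exprn_ge0 // -natrX ler_nat.
rewrite -[X in (X ^ _)%N](card_ord n) -(card_pffun_on y0).
by apply/subset_leq_card/subsetP=> f /andP[/andP[]].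
Qed.

End RandomGraph.

(** * Edge probabilities in the two random graph models *)

Lemma Gnp_edges (R : realFieldType) n (p : R) (A : {set {set 'I_n}}) : A \subset pairs n ->
  Pr (enum (powerset (pairs n))) (fun E => p ^+ #|E| * (1 - p) ^+ (#|pairs n| - #|E|))
    (fun E => A \subset E) = prefix_prod (fun=> p) #|A|.
Proof.
move=> sA; rewrite /Pr /prefix_prod big_enum_cond prodr_const card_ord /=.
(* [F] weighs a present edge and [F'] an absent one. Expanding the product of [F e + F' e] gives a
   sum over all edge sets, whose zero factors kill those not between [A] and [pairs n]. *)
pose F e : R := if e \in pairs n then p else 0.
pose F' e : R := if e \in pairs n then (if e \in A then 0 else 1 - p) else 1.
transitivity (\prod_e (F e + F' e)); last first.
  rewrite (bigID (mem A)) /= [X in _ * X]big1 => [|e eA].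
    rewrite mulr1 -prodr_const; apply: eq_bigr => e eA.
    by rewrite /F /F' (subsetP sA) // eA addr0.
  by rewrite /F /F' (negbTE eA); case: ifP => _; [ring | rewrite add0r].
rewrite bigA_distr big_mkcond /=; apply: eq_bigr => E _.
rewrite powersetE; case: ifP => [/andP[sE sAE]|ne].
  rewrite (bigID (mem E)) /=; congr *%R.
    rewrite -prodr_const; apply: eq_bigr => e eE.
    by rewrite eE /F (subsetP sE).
  rewrite -cardsDS // -prodr_const [RHS](bigID (mem (pairs n))) /=.
  rewrite [X in _ * X]big1 => [|e /andP[eE eP]].
    rewrite mulr1; apply: eq_big => [e|e]; rewrite inE // => /andP[eE eP].
    rewrite (negbTE eE) /F' eP; case: ifP => // /(subsetP sAE).
    by rewrite (negbTE eE).
  by rewrite (negbTE eE) /F' (negbTE eP).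
have [sE|/subsetPn[e eE eP]] := boolP (E \subset pairs n); last first.
  by rewrite (bigD1 e) //= eE /F (negbTE eP) mul0r.
move: ne; rewrite sE /= => /negbT/subsetPn[e eA eE].
by rewrite (bigD1 e) //= (negbTE eE) /F' (subsetP sA) // eA mul0r.
Qed.

Section UniformPrefix.
Variables (U : finType) (D : {set U}) (m : nat).
Hypothesis mD : (m <= #|D|)%N.
Let prm := permutations (enum D).
Let pre (s : seq U) : {set U} := [set e | e \in take m s].
Let cnt (A : {set U}) : nat := count (fun s => A \subset pre s) prm.

(** The transposition of [e] and [e'] permutes the orderings and fixes [A] pointwise. *)
Lemma count_prefix_sym (A : {set U}) e e' :
  e \in D -> e' \in D -> e \notin A -> e' \notin A -> cnt (e |: A) = cnt (e' |: A).
Proof.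
move=> eD e'D eA e'A; pose h : U -> U := tperm e e'.
have hK : involutive h by apply: tpermK.
have h_inj : injective h := inv_inj hK.
have hD x : (h x \in D) = (x \in D) by rewrite /h; case: tpermP => [->|->|]; rewrite ?eD ?e'D.
have hA x : x \in A -> h x = x.
  by move=> xA; rewrite /h tpermD //; apply: contraTneq xA => <-.
have hperm s : (map h s \in prm) = (s \in prm).
  rewrite /prm !mem_permutations; have hE : perm_eq (map h (enum D)) (enum D).
    apply: uniq_perm; rewrite ?map_inj_uniq ?enum_uniq // => x.
    by rewrite -{1}(hK x) mem_map // !mem_enum hD.
  apply/idP/idP => [p|/(perm_map h) /perm_trans]; last exact.
  by have := perm_map h p; rewrite (mapK hK) => /perm_trans; apply.
have pp : perm_eq (map (map h) prm) prm.
  apply: uniq_perm; rewrite ?(map_inj_uniq (inj_map h_inj)) ?permutations_uniq //.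
  by move=> s; rewrite -{1}(mapK hK s) mem_map ?hperm //; apply: inj_map.
rewrite /cnt -(seq.permP pp) count_map; apply: eq_count => s /=.
have mem x : (x \in pre (map h s)) = (h x \in pre s).
  by rewrite !inE -map_take -{1}(hK x) mem_map.
rewrite !subUset !sub1set mem /h tpermL; congr andb.
by apply/subsetP/subsetP => sub x xA; have := sub x xA; rewrite mem hA.
Qed.

(** Double counting of orderings whose prefix contains [A], with a marked further prefix element: by
    symmetry all marks are equally frequent, and each such prefix offers [m - #|A|] of them. *)
Lemma count_prefix_step (A : {set U}) e : A \subset D -> e \in D -> e \notin A ->
  (cnt (e |: A) * (#|D| - #|A|) = (m - #|A|) * cnt A)%N.
Proof.
move=> sA eD eA.
have -> : (cnt (e |: A) * (#|D| - #|A|) = \sum_(e' in D :\: A) cnt (e' |: A))%N.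
  rewrite (eq_bigr (fun=> cnt (e |: A))).
    by rewrite sum_nat_const cardsDS // mulnC.
  by move=> e'; rewrite inE => /andP[? ?]; apply: count_prefix_sym.
have cE (B : {set U}) : cnt B = (\sum_(s <- prm) (B \subset pre s))%N.
  by rewrite /cnt -sum1_count big_mkcond.
under eq_bigr => e' _ do rewrite cE.
rewrite exchange_big cE big_distrr /= big_seq [RHS]big_seq; apply: eq_bigr => s.
rewrite /prm mem_permutations => sD.
have pD : pre s \subset D.
  by apply/subsetP=> x; rewrite inE => /mem_take; rewrite (perm_mem sD) mem_enum.
have cp : #|pre s| = m.
  have us : uniq (take m s) by rewrite take_uniq // (perm_uniq sD) enum_uniq.
  by rewrite cardsE (card_uniqP us) size_takel // (perm_size sD) -cardE.
case: (boolP (A \subset pre s)) => Ap; last first.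
  by rewrite muln0 big1 // => x _; rewrite subUset (negbTE Ap) andbF.
rewrite muln1 -{1}cp -cardsDS // -sum1_card big_mkcond [RHS]big_mkcond /=.
apply: eq_bigr => x _; rewrite subUset sub1set Ap andbT !inE.
case xp: (x \in take m s); rewrite ?andbF; last by case: ifP.
by have /(subsetP pD) -> : x \in pre s; rewrite ?inE // andbT.
Qed.

Lemma prefix_edges (R : realFieldType) (A : {set U}) : A \subset D ->
  Pr prm (fun=> (size prm)%:R^-1 : R) (fun s => A \subset pre s) =
  prefix_prod (fun i => (m - i)%:R / (#|D| - i)%:R) #|A|.
Proof.
move=> sA.
have sz : (size prm)%:R != 0 :> R.
  by rewrite pnatr_eq0 -lt0n /prm size_permutations ?enum_uniq // fact_gt0.
suff h : (cnt A)%:R = (size prm)%:R * prefix_prod (fun i => (m - i)%:R / (#|D| - i)%:R : R) #|A|.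
  rewrite /Pr big_const_seq iter_addr addr0 (_ : count _ _ = cnt A) // -[_^-1 *+ _]mulr_natl h.
  by rewrite mulrAC mulfV // mul1r.
have [j ej] : {j | j = #|A|} by eexists.
elim: j A sA ej => [|j IH] A sA ej.
  rewrite -ej /prefix_prod big_ord0 mulr1; congr _%:R.
  have /eqP := esym ej; rewrite cards_eq0 => /eqP ->.
  by rewrite /cnt (eq_count (a2 := predT)) ?count_predT // => s; rewrite sub0set.
have /card_gt0P[e eA] : (0 < #|A|)%N by rewrite -ej.
have eB : e \notin A :\ e by rewrite !inE eqxx.
have sB : A :\ e \subset D by apply: subset_trans sA; apply: subD1set.
have cB : j = #|A :\ e| by have := cardsD1 e A; rewrite eA -ej; lia.
have eD := subsetP sA _ eA.
have := count_prefix_step sB eD eB; rewrite setD1K // -cB => st.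
have ltD : (j < #|D|)%N by rewrite ej subset_leq_card.
have Dj : (#|D| - j)%:R != 0 :> R by rewrite pnatr_eq0; lia.
have {}st := congr1 (fun x => x%:R : R) st; rewrite /= !natrM in st.
apply: (mulIf Dj); rewrite st (IH _ sB cB) -cB -ej /prefix_prod big_ord_recr /=.
by rewrite -!mulrA mulVf // mulr1 mulrC -!mulrA.
Qed.

End UniformPrefix.

End RandomGraphs.
Import RandomGraphs.
Delimit Scope R_scope with coqR.

(** * Threshold and hitting time *)

Section BlockPattern.
Variables (k r : nat) (EH : {set {set 'I_k}}).

Definition block_edge (p : 'I_r * {set 'I_k}) : {set 'I_r * 'I_k} := [set (p.1, x) | x in p.2].
(** The disjoint union of [r] copies of H; one application of the second moment method to it yields
    all the disjoint copies at once. *)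
Definition block_edges : {set {set 'I_r * 'I_k}} := block_edge @: setX setT EH.

Lemma card_block_edge e : is_graph EH -> e \in block_edges -> #|e| = 2.
Proof.
move=> /subsetP gH /imsetP[[t e']]; rewrite inE /= => /andP[_ /gH].
by rewrite inE => /eqP <- ->; rewrite card_imset // => x y [].
Qed.

(** Each edge lies inside one block, so the edges and the vertices of [W] both add up over its
    sections. *)
Lemma block_edges_density (m : R) :
  (forall W : {set 'I_k}, #|[set e in EH | e \subset W]|%:R <= m * #|W|%:R)%R ->
  forall W : {set 'I_r * 'I_k}, (#|[set e in block_edges | e \subset W]|%:R <= m * #|W|%:R)%R.
Proof.
move=> d W; pose sec t : {set 'I_k} := [set x | (t, x) \in W].
apply: (@le_trans _ _ (\sum_t #|[set e in EH | e \subset sec t]|)%:R%R).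
  rewrite ler_nat.
  have -> : \sum_t #|[set e in EH | e \subset sec t]| =
      #|[set p : 'I_r * {set 'I_k} | (p.2 \in EH) && (p.2 \subset sec p.1)]|.
    rewrite -[RHS]sum1_card (eq_bigl (fun p : 'I_r * {set 'I_k} =>
      true && ((p.2 \in EH) && (p.2 \subset sec p.1)))); last by move=> p; rewrite inE.
    rewrite -(pair_big_dep predT (fun t e => (e \in EH) && (e \subset sec t)) (fun _ _ => 1)) /=.
    by apply: eq_bigr => t _; rewrite -sum1_card; apply: eq_bigl => e; rewrite inE.
  apply: leq_trans (leq_imset_card block_edge _); apply/subset_leq_card/subsetP=> e.
  rewrite inE => /andP[/imsetP[[t e']]]; rewrite inE /= => /andP[_ e'H] -> sW.
  apply: imset_f; rewrite inE /= e'H; apply/subsetP=> x xe; rewrite inE.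
  by apply: (subsetP sW); apply: imset_f.
have -> : #|W| = \sum_t #|sec t|.
  rewrite -sum1_card (eq_bigl (fun p : 'I_r * 'I_k => true && ((p.1, p.2) \in W))); last by case.
  rewrite -(pair_big_dep predT (fun t x => (t, x) \in W) (fun _ _ => 1)) /=.
  by apply: eq_bigr => t _; rewrite -sum1_card; apply: eq_bigl => x; rewrite inE.
by rewrite !natr_sum big_distrr /=; apply: ler_sum.
Qed.

Lemma pattern_blocks n (EG : {set {set 'I_n}}) (f : {ffun 'I_r * 'I_k -> 'I_n}) :
  injective f -> im_edges block_edges f \subset EG ->
  forall t, embeds EH EG setT [ffun x => f (t, x)].
Proof.
move=> fi /subsetP fE t; apply/embedsP; split=> [x y|x|e eH].
- by rewrite !ffunE => /fi [].
- by rewrite inE.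
apply: fE; apply/imsetP; exists (block_edge (t, e)); first by apply: imset_f; rewrite inE eH inE.
by rewrite -imset_comp; apply: eq_imset => x; rewrite /= ffunE.
Qed.

End BlockPattern.

(** * Maximum density and the subgraphs attaining it *)

Section MaxDensity.
Variables (k : nat) (EH : {set {set 'I_k}}).
Local Open Scope R_scope.

Lemma foldr_Rmax_ge (T : eqType) (f : T -> R) (l : seq T) x :
  x \in l -> f x <= foldr Rmax 0 (map f l).
Proof.
elim: l => //= y l IH; rewrite inE => /orP[/eqP ->|/IH h]; first exact: Rmax_l.
by apply: Rle_trans h (Rmax_r _ _).
Qed.

(** A positive maximum cannot be the initial value 0 of the fold. *)
Lemma foldr_Rmax_attained (T : eqType) (f : T -> R) (l : seq T) :
  0 < foldr Rmax 0 (map f l) -> exists2 x, x \in l & f x = foldr Rmax 0 (map f l).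
Proof.
elim: l => /= [|y l IH]; first lra.
rewrite /Rmax; case: Rle_dec => _ h; last by exists y; rewrite ?mem_head.
by have [x xl fx] := IH h; exists x; rewrite // inE xl orbT.
Qed.

Lemma mH_ge x : is_subgraph EH x -> dens x <= mH EH.
Proof. by move=> sx; apply: foldr_Rmax_ge; rewrite mem_enum. Qed.

Lemma dens_mul (x : {set 'I_k} * {set {set 'I_k}}) : is_subgraph EH x ->
  INR #|x.2| = dens x * INR #|x.1|.
Proof.
case/and3P=> x0 _ _; rewrite /dens; field.
by apply: not_0_INR; apply/eqP; rewrite cards_eq0.
Qed.

Hypothesis gH : is_graph EH.

Lemma edge_subgraph e : e \in EH -> is_subgraph EH (e, [set e]).
Proof.
move=> eH; have := subsetP gH e eH; rewrite inE => /eqP e2.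
apply/and3P; split; rewrite /= ?sub1set //.
  by rewrite -card_gt0 e2.
by apply/forall_inP=> e'; rewrite inE => /eqP ->.
Qed.

Lemma mH_gt0 : EH != set0 -> 0 < mH EH.
Proof.
case/set0Pn=> e eH; have s := edge_subgraph eH; apply: Rlt_le_trans (mH_ge s).
have := subsetP gH e eH; rewrite inE => /eqP e2.
by rewrite /dens /= cards1 e2 /=; lra.
Qed.

Lemma induced_subgraph (W : {set 'I_k}) : W != set0 ->
  is_subgraph EH (W, [set e in EH | e \subset W]).
Proof.
move=> W0; apply/and3P; split=> //=.
  by apply/subsetP=> e; rewrite inE => /andP[].
by apply/forall_inP=> e; rewrite inE => /andP[].
Qed.

Lemma induced_density (m : R) :
  (forall x, is_subgraph EH x -> dens x <= m) ->
  forall W : {set 'I_k}, (#|[set e in EH | e \subset W]|%:R <= m * #|W|%:R)%R.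
Proof.
(* The empty set is excluded by [is_subgraph], but it spans no edge. *)
move=> hm W; have [->|W0] := eqVneq W set0.
  rewrite cards0 mulr0 (_ : [set e in EH | _] = set0) ?cards0 //.
  apply/setP=> e; rewrite !inE subset0; case eH: (e \in EH) => //=.
  by have := subsetP gH e eH; rewrite inE; apply: contraTF => /eqP ->; rewrite cards0.
have s := induced_subgraph W0; rewrite -!INRE; apply/RleP; rewrite (dens_mul s).
by apply: Rmult_le_compat_r; [apply: pos_INR | apply: hm].
Qed.

End MaxDensity.

Lemma prob_GnpE n (p : R) P : prob_Gnp p P =
  Pr (enum (powerset (pairs n)))
    (fun E => (p ^+ #|E| * (1 - p) ^+ (#|pairs n| - #|E|))%R) P.
Proof.
rewrite /prob_Gnp /Pr; elim: (enum _) => [|E l IH] /=; first by rewrite big_nil.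
by rewrite big_cons; case: ifP => //= _; rewrite IH !RpowE.
Qed.

Lemma prob_processE n (Q : pred (seq {set 'I_n})) : prob_process Q =
  Pr (permutations (enum (pairs n))) (fun=> (size (permutations (enum (pairs n))))%:R^-1 : R)%R Q.
Proof.
rewrite /prob_process RdivE !INRE /Pr big_const_seq iter_addr addr0.
by rewrite -[RHS]mulr_natl.
Qed.

Lemma Un_cv_1 (v : nat -> R) :
  (forall eps : R, (0 < eps)%R -> exists n0, forall n,
     (n0 <= n)%N -> (v n <= 1 /\ 1 - v n < eps)%R) ->
  Un_cv v 1.
Proof.
move=> h eps /RltP e0; have [n0 hn] := h _ e0; exists n0 => n /ssrnat.leP /hn[/RleP v1 /RltP ve].
rewrite /Rdist Rabs_left1; first by rewrite -[1%R]/(IZR 1) in ve; rewrite -RminusE in ve; lra.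
by rewrite -[1%R]/(IZR 1) in v1; lra.
Qed.

(** * The threshold in the binomial random graph *)

Section BinomialThreshold.
Variables (k a b : nat) (EH : {set {set 'I_k}}).
Hypotheses (a0 : (0 < a)%N) (gH : is_graph EH) (H0 : EH != set0).
Variable p : nat -> R.
Hypothesis p01 : forall n, (0 <= p n <= 1)%R.

Let Gnp_weight n (E : {set {set 'I_n}}) : R :=
  (p n ^+ #|E| * (1 - p n) ^+ (#|pairs n| - #|E|))%R.

Lemma Gnp_weight_ge0 n (E : {set {set 'I_n}}) : (0 <= Gnp_weight E)%R.
Proof.
have /andP[h0 h1] := p01 n; rewrite mulr_ge0 ?exprn_ge0 //.
by rewrite subr_ge0.
Qed.

Let Gnp_edges_p n := @Gnp_edges R n (p n).

Lemma Gnp_Waiter_wins :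
  tends_to_infty (fun n => (p n / thr EH n)%R) ->
  Un_cv (fun n => prob_Gnp (p n) (@WaiterWin k EH a b n)) 1.
Proof.
move=> pinf; pose r := b.+1 ^ k; pose V := ('I_r * 'I_k)%type.
have [n0 win] := WaiterWin_of_blocks a0 (board_winnable_exp b k a0).
pose C : R := ((2 * #|{: V}|.+1%:R) ^+ #|{: V}|)%R.
apply: Un_cv_1 => eps e0.
(* The 1 is for [dense_power_lb], applied with [lam = p n / thr EH n]; [C / eps] pushes the failure
   bound [C / lam] below [eps]. *)
have [n1 hn1] := pinf (Rmax 1 (C / eps)).
exists (maxn n0 (maxn n1 (maxn 1 #|{: V}|.*2))) => n.
rewrite !geq_max => /andP[nn0 /andP[nn1 /andP[n1' nV]]].
have /andP[p0 p1] := p01 n.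
rewrite prob_GnpE; split.
  by apply: (Pr_le1 (@Gnp_weight_ge0 n) (@Gnp_edges_p n)).
rewrite (PrC (@Gnp_edges_p n)) opprB addrC subrK.
set lam := (p n / thr EH n)%R.
have m0 := mH_gt0 gH H0.
have lt1 : (1 < lam)%coqR by apply: Rle_lt_trans (Rmax_l _ _) (hn1 n nn1).
have lt2 : (C / eps < lam)%R by apply/RltP; apply: Rle_lt_trans (Rmax_r _ _) (hn1 n nn1).
have lam0 : (0 < lam)%R by apply/RltP; apply: Rlt_trans lt1; apply: Rlt_0_1.
apply: (@le_lt_trans _ _ (1 ^+ #|block_edges r EH| * C / lam)%R); last first.
  by rewrite expr1n mul1r ltr_pdivrMr // mulrC -ltr_pdivrMr.
apply: (@le_trans _ _ (Pr (enum (powerset (pairs n))) (@Gnp_weight n)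
    (fun E => ~~ has_pattern id (block_edges r EH) E))).
  apply: Pr_mono; first exact: Gnp_weight_ge0.
  move=> E; apply: contra => /existsP[f /andP[/injectiveP fi fE]].
  exact: (win _ _ _ f nn0 fi (pattern_blocks fi fE)).
apply: (Pr_no_pattern (@Gnp_weight_ge0 n) (fun=> p0) (fun=> lexx _) (@Gnp_edges_p n)) => //.
- by move=> e; apply: card_block_edge.
- by rewrite mul1r.
move=> W j /andP[j0 jW]; rewrite -INRE -!RpowE; apply/RleP.
apply: (@dense_power_lb _ (mH EH)) => //.
- by apply: (le_INR 1); apply/ssrnat.leP.
- exact: Rlt_le.
- right; rewrite /lam /thr.
  change (p n / Rpower (INR n) (- / mH EH) * Rpower (INR n) (- / mH EH) = p n)%coqR.
  by field; apply: Rgt_not_eq; apply: exp_pos.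
rewrite !INRE; apply/RleP.
apply: le_trans (block_edges_density (induced_density gH (@mH_ge _ EH)) W).
by rewrite ler_nat.
Qed.

(** First moment on a densest subgraph, with [w] vertices and [e] edges: there [n ^ w * p ^ e]
    equals [lam ^ e], [lam] being the ratio of [p] to the threshold. *)
Lemma Gnp_Client_wins :
  Un_cv (fun n => (p n / thr EH n)%R) 0 ->
  Un_cv (fun n => prob_Gnp (p n) (fun E => ~~ @WaiterWin k EH a b n E)) 1.
Proof.
move=> pz; have m0 := mH_gt0 gH H0.
have [[W E'] xs xd] := foldr_Rmax_attained m0.
rewrite mem_enum inE in xs.
have dm := dens_mul xs; rewrite -/(mH EH) in xd; rewrite xd /= in dm.
case/and3P: (xs) => /= W0 sE /forall_inP EW.
have E0 : (0 < #|E'|)%N.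
  rewrite lt0n; apply/eqP=> E0; rewrite E0 in dm.
  have W0R : (0 < INR #|W|)%coqR by apply: lt_0_INR; apply/ssrnat.ltP; rewrite card_gt0.
  by have := Rmult_lt_0_compat _ _ m0 W0R; rewrite -dm; apply: Rlt_irrefl.
apply: Un_cv_1 => eps e0.
have e1 : (Rmin 1 eps > 0)%coqR by apply: Rmin_pos; [apply: Rlt_0_1 | apply/RltP].
have [n1 hn1] := pz _ e1.
exists (maxn n1 1) => n; rewrite geq_max => /andP[/ssrnat.leP /hn1 lt n0].
have /andP[p0 p1] := p01 n.
rewrite prob_GnpE; split.
  by apply: (Pr_le1 (@Gnp_weight_ge0 n) (@Gnp_edges_p n)).
rewrite (PrC (@Gnp_edges_p n)) opprB addrC subrK.
move: lt; rewrite /Rdist; set lam := (p n / thr EH n)%R.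
have thr0 : (0 < thr EH n)%coqR by apply: exp_pos.
have lam0 : (0 <= lam)%coqR.
  apply: Rle_mult_inv_pos => //; exact/RleP.
rewrite Rminus_0_r Rabs_pos_eq // => lt.
have lt1 := Rlt_le_trans _ _ _ lt (Rmin_l _ _).
have /RltP lt2 := Rlt_le_trans _ _ _ lt (Rmin_r _ _).
apply: le_lt_trans lt2.
apply: (@le_trans _ _ (Pr (enum (powerset (pairs n))) (@Gnp_weight n) (has_pattern id E'))).
  apply: Pr_mono; first exact: Gnp_weight_ge0.
  move=> E; rewrite negbK; apply: contraLR => noP; apply: ww_noH.
  apply: contra noP => /existsP[f /embedsP[fi _ fE]]; apply/existsP; exists f.
  apply/andP; split; first exact/injectiveP.
  by apply/subsetP=> _ /imsetP[e eE ->]; apply/fE/(subsetP sE).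
apply: le_trans (Pr_subpattern
  (@Gnp_weight_ge0 n) (fun=> p0) (fun=> lexx _) (@Gnp_edges_p n) n0 _ EW) _.
  by move=> e /(subsetP sE) /(subsetP gH); rewrite inE => /eqP.
have -> : p n = (lam * Rpower (INR n) (- / mH EH))%coqR.
  by rewrite /lam -/(thr EH n) -RdivE; field; lra.
rewrite -INRE -!RpowE; apply/RleP; apply: sparse_power_ub => //; last exact: Rlt_le.
by apply: (le_INR 1); apply/ssrnat.leP.
Qed.

End BinomialThreshold.

(** * Hitting times and meeting copies in the random graph process *)

Section RandomProcess.

Lemma Gi_sub n (s : seq {set 'I_n}) i m : (i <= m)%N -> Gi s i \subset Gi s m.
Proof.
move=> im; apply/subsetP=> e; rewrite !inE.
by rewrite -(minn_idPl im) take_min; apply: mem_take.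
Qed.

(** Both first hits occur by time [m], and up to then the properties agree. *)
Lemma tau_eq n (s : seq {set 'I_n}) (P Q : {set {set 'I_n}} -> bool) m :
  (m <= size s)%N -> (forall i, (i <= m)%N -> P (Gi s i) = Q (Gi s i)) -> P (Gi s m) ->
  tau s P = tau s Q.
Proof.
move=> ms PQ Pm; rewrite /tau.
have -> : iota 0 (size s).+1 = iota 0 m.+1 ++ iota m.+1 (size s - m).
  by rewrite -[m.+1 in RHS]add0n -iotaD; congr iota; lia.
have inm : m \in iota 0 m.+1 by rewrite mem_iota; lia.
have hP : has (fun i => P (Gi s i)) (iota 0 m.+1) by apply/hasP; exists m.
have hQ : has (fun i => Q (Gi s i)) (iota 0 m.+1) by apply/hasP; exists m; rewrite -?PQ.
rewrite !find_cat hP hQ; apply: eq_in_find => i; rewrite mem_iota add0n ltnS => /andP[_ im].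
exact: PQ.
Qed.

Variables (k : nat) (EH : {set {set 'I_k}}).

Definition meeting_copies n (f g : {ffun 'I_k -> 'I_n}) : bool :=
  (meet_vertices f g != set0) &&
  ((f @: setT, im_edges EH f) != (g @: setT, im_edges EH g)).

Lemma disjoint_copies_of_no_meeting n (EG : {set {set 'I_n}}) :
  ~~ [exists f : {ffun 'I_k -> 'I_n}, exists g : {ffun 'I_k -> 'I_n},
    [&& injectiveb f, injectiveb g, meeting_copies f g &
        im_edges EH f :|: im_edges EH g \subset EG]] ->
  disjoint_copies EH EG.
Proof.
move=> no; apply/forall_inP=> c /imsetP[f]; rewrite inE => /embedsP[fi _ fe] ->.
apply/forall_inP=> c' /imsetP[g]; rewrite inE => /embedsP[gi _ ge] ->.
apply/implyP=> ne; rewrite -setI_eq0; apply: contraR no => /set0Pn[y].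
rewrite inE /= => /andP[yf /imsetP[x _ yx]].
apply/existsP; exists f; apply/existsP; exists g; apply/and4P; split.
- exact/injectiveP.
- exact/injectiveP.
- by apply/andP; split=> //; apply/set0Pn; exists x; rewrite inE -yx.
by rewrite subUset; apply/andP; split; apply/subsetP=> _ /imsetP[e eE ->]; [apply: fe | apply: ge].
Qed.

Hypotheses (k0 : (0 < k)%N) (gH : is_graph EH) (sb : strictly_balanced EH).

Lemma strictly_balanced_lt (W : {set 'I_k}) (J : {set {set 'I_k}}) :
  is_subgraph EH (W, J) -> (W, J) != (setT, EH) -> (#|J| * k < #|W| * #|EH|)%N.
Proof.
move=> s ne; have := sb s ne; rewrite /dens /= cardsT card_ord => lt.
case/and3P: s => /= W0 _ _.
have w0 : (0 < INR #|W|)%coqR by apply: lt_0_INR; apply/ssrnat.ltP; rewrite card_gt0.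
have k0R : (0 < INR k)%coqR by apply: lt_0_INR; apply/ssrnat.ltP.
apply/ssrnat.ltP/INR_lt; rewrite !mult_INR.
have := Rmult_lt_compat_r _ _ _ (Rmult_lt_0_compat _ _ w0 k0R) lt.
have -> : (INR #|J| / INR #|W| * (INR #|W| * INR k) = INR #|J| * INR k)%coqR by field; lra.
have -> : (INR #|EH| / INR k * (INR #|W| * INR k) = INR #|W| * INR #|EH|)%coqR by field; lra.
by [].
Qed.

(** A single edge has density 1/2. The bound guarantees that the number of edges at the inspected
    density tends to infinity. *)
Lemma strictly_balanced_order_le : EH != set0 -> (k <= 2 * #|EH|)%N.
Proof.
case/set0Pn=> e eH; have s := edge_subgraph gH eH.
have := subsetP gH e eH; rewrite inE => /eqP e2.
have [[eT EE]|ne] := eqVneq (e, [set e]) (setT, EH).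
  have : #|e| = k by rewrite eT cardsT card_ord.
  by rewrite -EE cards1 e2; lia.
have := strictly_balanced_lt s ne; rewrite cards1 e2; lia.
Qed.

(** The common part, pulled back along [g], is a subgraph of H. It is proper: otherwise the image of
    [g] would lie in that of [f], and equal cardinalities would make the two copies equal. *)
Lemma meeting_copies_lt n (f g : {ffun 'I_k -> 'I_n}) :
  injective f -> injective g -> meeting_copies f g ->
  (#|im_edges EH f :&: im_edges EH g| * k < #|meet_vertices f g| * #|EH|)%N.
Proof.
move=> fi gi /andP[W0 ne]; rewrite card_im_edgesI //; apply: strictly_balanced_lt.
  apply/and3P; split=> //=; first by apply/subsetP=> e; rewrite inE => /andP[].
  by apply/forall_inP=> e; rewrite inE => /andP[_ /common_edge_sub].
apply: contra ne => /eqP[WT JE]; apply/eqP; congr pair.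
  apply/esym/eqP; rewrite eqEcard !card_imset // leqnn andbT.
  apply/subsetP=> _ /imsetP[x _ ->].
  by have h : x \in meet_vertices f g; [rewrite WT inE | rewrite inE in h].
apply/esym/eqP; rewrite eqEcard !card_im_edges // leqnn andbT.
apply/subsetP=> _ /imsetP[e eE ->].
have : e \in [set e in EH | g @: e \in im_edges EH f] by rewrite JE.
by rewrite inE => /andP[].
Qed.

(* Only [k = 1] is possible here. *)
Lemma disjoint_copies_edgeless n (EG : {set {set 'I_n}}) : EH = set0 -> disjoint_copies EH EG.
Proof.
move=> E0; apply: disjoint_copies_of_no_meeting.
apply/existsPn=> f; apply/existsPn=> g.
apply/negP=> /and4P[/injectiveP fi /injectiveP gi /(meeting_copies_lt fi gi)].
by rewrite E0 cards0 muln0.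
Qed.

End RandomProcess.

(** * Conditional edge probabilities at a fixed time of the process *)

Section UniformDensity.
Variables (m M : nat).
Hypothesis mM : (m <= M)%N.
Let u (i : nat) : R := ((m - i)%:R / (M - i)%:R)%R.

Lemma uniform_ratio_ge0 i : (0 <= u i)%R.
Proof. by rewrite divr_ge0 ?ler0n. Qed.

Lemma uniform_ratio_noninc i : (u i.+1 <= u i)%R.
Proof.
(* Past [M] the truncated denominator is 0, and so is the quotient. *)
rewrite /u; have [Mi|Mi] := leqP M i.+1.
  have -> : (M - i.+1 = 0)%N by lia.
  by rewrite invr0 mulr0 divr_ge0 ?ler0n.
rewrite ler_pdivrMr ?ltr0n ?subn_gt0 // mulrAC ler_pdivlMr ?ltr0n ?subn_gt0; last exact: ltnW.
rewrite -!natrM ler_nat; nia.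
Qed.

Lemma uniform_ratio_half e : (2 * e <= m)%N -> (0 < M)%N -> (u 0 <= 2 * u e)%R.
Proof.
move=> em M0; rewrite /u !subn0; have [->|e0] := posnP e.
  rewrite !subn0 [(2 * _)%R]mulr_natl mulr2n lerDl divr_ge0 ?ler0n //.
have eM : (e < M)%N by lia.
rewrite ler_pdivrMr ?ltr0n // mulrA mulrAC ler_pdivlMr ?ltr0n ?subn_gt0 //.
rewrite -!natrM ler_nat; nia.
Qed.

End UniformDensity.

Section ProcessTime.
Local Open Scope R_scope.

(** The time [m] is an integer between [p0 * M] and [2 * p0 * M], with [M] the number of pairs. It
    is large because [k <= 2 * e] makes [p0 * n ^ 2] grow, and at most [M] because [p0 <= 1/2]. *)
Lemma process_time (k e : nat) (B : R) : (0 < e)%N -> (0 < k)%N -> (k <= 2 * e)%N ->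
  exists n0, forall n, (n0 <= n)%N -> exists m : nat,
    let p0 := Rpower (INR n) (/ (4 * INR e ^ 2) - INR k / INR e)%coqR in
    [/\ (m <= 'C(n, 2))%N, (B <= INR m)%coqR, (0 < 'C(n, 2))%N,
        (p0 <= INR m / INR 'C(n, 2))%coqR & (INR m / INR 'C(n, 2) <= 2 * p0)%coqR].
Proof.
move=> e0 k0 ke.
have eR : 1 <= INR e by apply: (le_INR 1); apply/ssrnat.leP.
have kR : 1 <= INR k by apply: (le_INR 1); apply/ssrnat.leP.
have keR : INR k <= 2 * INR e by have /ssrnat.leP/le_INR := ke; rewrite mult_INR.
have eps0 : 0 < / (4 * INR e ^ 2) by apply: Rinv_0_lt_compat; nra.
have nu0 : 0 < / (2 * INR e) by apply: Rinv_0_lt_compat; lra.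
(* The factor 4 compensates for the estimate ['C(n, 2) >= n ^ 2 / 4]. *)
have [n1 h1] := Rpower_nat_unbounded (4 * Rmax 1 B) eps0.
have [n2 h2] := Rpower_nat_vanish (B := / 2) nu0 ltac:(lra).
exists (maxn 2 (maxn n1 n2)) => n; rewrite !geq_max => /andP[n2' /andP[/h1 lam /h2 nu]].
have nR : 2 <= INR n by apply: (le_INR 2); apply/ssrnat.leP.
have MR : INR 'C(n, 2) = INR n * (INR n - 1) / 2.
  have := congr1 INR (mul_bin_diag n 1); rewrite bin1 !mult_INR -subn1 minus_INR /=; first lra.
  by apply/ssrnat.leP; apply: ltnW.
set p0 := Rpower _ _.
have p0pos : 0 < p0 by apply: exp_pos.
have M0 : 0 < INR 'C(n, 2) by rewrite MR; nra.
have Mn : INR n ^ 2 / 4 <= INR 'C(n, 2) by rewrite MR; nra.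
have p0n : Rpower (INR n) (/ (4 * INR e ^ 2)) <= p0 * INR n ^ 2.
  rewrite -(Rpower_pow 2 (INR n)); last lra.
  rewrite /p0 -Rpower_plus; apply: Rpower_le1; first lra.
  have : INR k / INR e <= 2.
    apply: (Rmult_le_reg_r (INR e)); first lra.
    by have -> : INR k / INR e * INR e = INR k by field; lra.
  by rewrite /=; lra.
have p0M : Rmax 1 B <= p0 * INR 'C(n, 2).
  have : p0 * (INR n ^ 2 / 4) <= p0 * INR 'C(n, 2) by apply: Rmult_le_compat_l; lra.
  lra.
have p0half : p0 <= / 2.
  apply: Rle_trans (Rlt_le _ _ nu); apply: Rpower_le1; first lra.
  have i4 : / (4 * INR e ^ 2) <= / (4 * INR e) by apply: Rinv_le_contravar; nra.
  have -> : / (2 * INR e) = / 2 * / INR e by field; lra.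
  have e4 : / (4 * INR e) = / 4 * / INR e by field; lra.
  have : / INR e <= INR k / INR e.
    rewrite /Rdiv -{1}(Rmult_1_l (/ INR e)); apply: Rmult_le_compat_r => //.
    by left; apply: Rinv_0_lt_compat; lra.
  have : 0 < / INR e by apply: Rinv_0_lt_compat; lra.
  lra.
have [m [m1 m2]] := ex_nat_between (Rle_trans _ _ _ (Rmax_l 1 B) p0M).
exists m => /=; split.
- apply/ssrnat.leP/INR_le; apply: Rle_trans m2 _; nra.
- by apply: Rle_trans m1; apply: Rle_trans p0M; apply: Rmax_r.
- by apply/ssrnat.ltP/INR_lt.
- apply: (Rmult_le_reg_r (INR 'C(n, 2))) => //.
  by have -> : INR m / INR 'C(n, 2) * INR 'C(n, 2) = INR m by field; lra.
- apply: (Rmult_le_reg_r (INR 'C(n, 2))) => //.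
  by have -> : INR m / INR 'C(n, 2) * INR 'C(n, 2) = INR m; [field; lra | lra].
Qed.

End ProcessTime.

(** Failure is covered by two rare events at time [m]: no [N] disjoint copies, or two distinct
    copies that meet. Outside them, all graphs up to time [m] have disjoint copies and [tau_eq]
    applies. *)
Lemma process_hitting_time (k a b N n0 : nat) (EH : {set {set 'I_k}}) :
  (0 < k)%N -> is_graph EH -> strictly_balanced EH ->
  (forall n (EG : {set {set 'I_n}}), (n0 <= n)%N -> disjoint_copies EH EG ->
     WaiterWin EH a b EG = hasNcopies N EH EG) ->
  Un_cv (fun n => prob_process (fun s : seq {set 'I_n} =>
     tau s (@WaiterWin k EH a b n) == tau s (@hasNcopies N k EH n))) 1.
Proof.
move=> k0 gH sb win; apply: Un_cv_1 => eps e0.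
have w0 n (s : seq {set 'I_n}) :
    (0 <= (size (permutations (enum (pairs n))))%:R^-1 :> R)%R by rewrite invr_ge0 ler0n.
have [E0|E0] := eqVneq EH set0.
  exists n0 => n nn0; rewrite prob_processE.
  (* Without edges the hitting times agree on every ordering; time 0 is used just to see that the
     total mass is 1. *)
  have edges := @prefix_edges _ (pairs n) 0 (leq0n _) R.
  rewrite (PrC (G := fun s => Gi s 0) edges) /Pr big1 ?subr0 ?subrr; first by split.
  move=> s /negP[]; apply/eqP; apply: eq_find => i.
  by rewrite win //; apply: disjoint_copies_edgeless.
pose e := #|EH|; pose V := ('I_N * 'I_k)%type; pose EV := block_edges N EH.
have ege : (0 < e)%N by rewrite card_gt0.
have ke := strictly_balanced_order_le k0 gH sb E0.
have eR : (1 <= INR e)%coqR by apply: (le_INR 1); apply/ssrnat.leP.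
have kR : (1 <= INR k)%coqR by apply: (le_INR 1); apply/ssrnat.leP.
have eps0 : (0 < / (4 * INR e ^ 2))%coqR by apply: Rinv_0_lt_compat; nra.
have nu0 : (0 < / (2 * INR e))%coqR by apply: Rinv_0_lt_compat; lra.
(* [C1] is the constant of [Pr_no_pattern] with [c = 2]; [C2] joins those of [pair_power_ub] and
   [Pr_pattern_pair]. *)
pose C1 : R := (2 ^+ #|EV| * (2 * #|{: V}|.+1%:R) ^+ #|{: V}|)%R.
pose C2 : R := (2 ^+ e.*2 * k.+1%:R ^+ k)%R.
have C20 : (0 < C2)%R by rewrite mulr_gt0 ?exprn_gt0 ?ltr0n.
have [n1 h1] := Rpower_nat_unbounded (Rmax 1 (C1 / (eps / 2))%R) eps0.
have [n2 h2] : exists n2 : nat, forall n : nat, (n2 <= n)%N ->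
    Rlt (Rpower (INR n) (- / (2 * INR e))%coqR) (eps / 2 / C2)%R.
  by apply: Rpower_nat_vanish => //; apply/RltP; rewrite !divr_gt0.
(* At least [2 * #|EV|] edges have to be present for [uniform_ratio_half] to give [c = 2]. *)
have [n3 h3] := process_time (INR (2 * #|EV|)) ege k0 ke.
exists (maxn n0 (maxn n1 (maxn n2 (maxn n3 (maxn 1 #|{: V}|.*2))))) => n.
rewrite !geq_max => /andP[nn0 /andP[nn1 /andP[nn2 /andP[nn3 /andP[n1' nV]]]]].
have [m] := h3 n nn3; rewrite -[n in 'C(n, _)]card_ord -card_draws -/(pairs n).
set p0 := Rpower _ _; rewrite /= => -[mM me M0 up0 u2p0].
have edges := @prefix_edges _ (pairs n) m mM R.
pose u (i : nat) : R := ((m - i)%:R / (#|pairs n| - i)%:R)%R.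
have u0E : u 0 = (INR m / INR #|pairs n|)%coqR by rewrite /u !subn0 RdivE !INRE.
have uge := uniform_ratio_ge0 m #|pairs n|.
have uni := uniform_ratio_noninc mM.
have nR : (1 <= INR n)%coqR by apply: (le_INR 1); apply/ssrnat.leP.
rewrite prob_processE; split; first exact: (Pr_le1 (w0 n) (G := fun s => Gi s m) edges).
rewrite (PrC (G := fun s => Gi s m) edges) opprB addrC subrK.
pose pat := has_pattern (fun s : seq {set 'I_n} => Gi s m) EV.
pose mt (s : seq {set 'I_n}) := [exists f : {ffun 'I_k -> 'I_n}, exists g : {ffun 'I_k -> 'I_n},
  [&& injectiveb f, injectiveb g, meeting_copies EH f g &
      im_edges EH f :|: im_edges EH g \subset Gi s m]].
apply: (@le_lt_trans _ _ (Pr (permutations (enum (pairs n)))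
    (fun=> (size (permutations (enum (pairs n))))%:R^-1 : R)%R (fun s => ~~ pat s) +
  Pr (permutations (enum (pairs n)))
    (fun=> (size (permutations (enum (pairs n))))%:R^-1 : R)%R mt)%R).
  apply: (Pr_subU (w0 n)) => s sP; apply: contraR; rewrite negb_or negbK.
  case/andP=> /existsP[f /andP[/injectiveP fi fE]] nmt.
  have dis := disjoint_copies_of_no_meeting nmt.
  have hN := hasNcopies_of_blocks k0 fi (pattern_blocks fi fE).
  apply/eqP; apply: (@tau_eq _ _ _ _ m).
  - by move: sP; rewrite mem_permutations => /perm_size ->; rewrite -cardE.
  - by move=> i im; apply: win => //; apply: disjoint_copiesS dis; apply: Gi_sub.
  - by rewrite win.
rewrite [eps](_ : _ = (eps / 2 + eps / 2)%R); last by rewrite -splitr.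
apply: ltr_leD; last first.
  apply: le_trans (Pr_pattern_pair (w0 n) uge uni edges (E := EH) (bad := @meeting_copies k EH n)
    (mu := (2 ^+ e.*2 * Rpower (INR n) (- / (2 * INR e))%coqR)%R) _ n1' _ _) _.
  - by move=> x /(subsetP gH); rewrite inE => /eqP.
  - by rewrite mulr_ge0 ?exprn_ge0 ?ler0n //; apply/RleP; apply: Rlt_le; apply: exp_pos.
  - move=> f g fi gi bad; rewrite card_ord -/(u 0) card_im_edgesU // -(INRE n) -!RpowE; apply/RleP.
    apply: pair_power_ub => //.
    + by apply/RleP; apply: uge.
    + by rewrite -(card_im_edges EH fi) subset_leq_card ?subsetIl.
    + exact: meeting_copies_lt.
    + by rewrite u0E.
  rewrite card_ord mulrAC -/C2 mulrC -ler_pdivlMr //.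
  by apply/RleP; apply: Rlt_le; apply: h2.
have lam1 := Rle_lt_trans _ _ _ (Rmax_l _ _) (h1 n nn1).
have /RltP lam2 := Rle_lt_trans _ _ _ (Rmax_r _ _) (h1 n nn1).
set lam := Rpower _ _ in lam1 lam2.
have lam0 : (0 < lam)%R by apply/RltP; apply: exp_pos.
apply: (@le_lt_trans _ _ (C1 / lam)%R); last first.
  by rewrite ltr_pdivrMr // mulrC -ltr_pdivrMr // divr_gt0.
apply: (Pr_no_pattern (w0 n) uge uni edges) => //.
- by move=> x; apply: card_block_edge.
- by rewrite ler1n.
- apply: uniform_ratio_half => //.
  by apply/ssrnat.leP/INR_le.
move=> W j /andP[j0 jW]; rewrite -/(u 0) -(INRE n) -!RpowE; apply/RleP.
(* By strict balance [e / k] is the maximum density; [p0] is [lam] times [n ^ (- k / e)]. *)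
apply: (@dense_power_lb _ (INR e / INR k)%coqR) => //.
- by apply: Rdiv_lt_0_compat; lra.
- exact: Rlt_le.
- rewrite u0E; apply: Rle_trans up0; right; rewrite /lam /p0 -Rpower_plus; congr Rpower.
  by rewrite -/e; field; lra.
rewrite (INRE j) (INRE #|W|); apply/RleP.
apply: le_trans (block_edges_density (induced_density gH _) W); first by rewrite ler_nat.
move=> [X J] s; have [->|ne] := eqVneq (X, J) (setT, EH).
  by rewrite /dens /= cardsT card_ord; apply: Rle_refl.
by have := sb _ s ne; rewrite {2}/dens /= cardsT card_ord => /Rlt_le.
Qed.

Local Open Scope R_scope.

Theorem theorem8 (k a b : nat) :
  (0 < k)%N -> (0 < a)%N -> (0 < b)%N ->
  (forall EH : {set {set 'I_k}}, is_graph EH -> EH != set0 ->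
     forall p : nat -> R, (forall n, (0 <= p n <= 1)) ->
       (tends_to_infty (fun n => (p n / thr EH n)) ->
          Un_cv (fun n => prob_Gnp (p n) (@WaiterWin k EH a b n)) 1) /\
       (Un_cv (fun n => (p n / thr EH n)) 0 ->
          Un_cv (fun n => prob_Gnp (p n) (fun E => ~~ @WaiterWin k EH a b n E)) 1))
  /\
  (exists N : nat, forall EH : {set {set 'I_k}}, is_graph EH -> strictly_balanced EH ->
     Un_cv (fun n => prob_process (fun s : seq {set 'I_n} =>
              tau s (@WaiterWin k EH a b n) == tau s (@hasNcopies N k EH n))) 1).
Proof.
move=> k0 a0 _; split.
  move=> EH gH H0 p p01.
  have p01' n : (0 <= p n <= 1)%R.
    by have [/RleP h0 /RleP h1] := p01 n; apply/andP; split.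
  by split; [apply: Gnp_Waiter_wins | apply: Gnp_Client_wins].
(* The board depends on [a], [b] and [k] alone, so [N] is fixed before the edges of H. *)
have [N [n0 win]] := WaiterWin_copies b k a0.
exists N => EH gH sb; apply: (@process_hitting_time _ _ _ _ n0) => // n EG.
exact: win.
Qed.
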